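(* Let $k$ be a commutative Noetherian ring, $R=k_{\mathfrak q}[x_1,\ldots,x_n]$ a skew polynomial ring, and $I$ a stable ideal in $R$. Then the complex $(L_\bullet(I),d)$ (defined in the context) is a free resolution of $I$ over $R$; that is, the sequence of right $R$-modules $$\cdots\to L_q(I)\xrightarrow{d}L_{q-1}(I)\to\cdots\to L_1(I)\xrightarrow{d}L_0(I)\xrightarrow{\varepsilon}I\to 0,\qquad \varepsilon(e(\emptyset;u))=u,$$ is exact. Moreover, if $k$ is a field, then $(L_\bullet(I),d)$ is a minimal free resolution of $I$, i.e. $d(L_q(I))\subseteq L_{q-1}(I)\,(x_1,\ldots,x_n)$ for all $q\ge 1$.
   Context: Skew polynomial ring: $k$ is a commutative Noetherian ring, $q_{i,j}\in k^*$ ($1\le i,j\le n$) satisfy $q_{i,i}=1$ and $q_{j,i}=q_{i,j}^{-1}$, and $R=k_{\mathfrak q}[x_1,\ldots,x_n]$ is the iterated Ore extension of $k$ with $k$ central and $x_ix_j=q_{i,j}x_jx_i$. Let $X=\{\mathbf x^{\mathbf a}=x_1^{a_1}\cdots x_n^{a_n}\mid \mathbf a\in\mathbb N^n\}$ be the set of monomials (a $k$-basis of $R$). Put $\mathbf x^{\mathbf a}*\mathbf x^{\mathbf b}:=\mathbf x^{\mathbf a+\mathbf b}$, and $\frac{\mathbf x^{\mathbf a}}{\mathbf x^{\mathbf b}}:=\mathbf x^{\mathbf a-\mathbf b}$ when $a_i\ge b_i$ for all $i$. Multiples of monomials are taken with respect to $*$. The function $C:X\times X\to k^*$ is defined by $\mathbf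 x^{\mathbf a}\mathbf x^{\mathbf b}=C(\mathbf x^{\mathbf a},\mathbf x^{\mathbf b})\,\mathbf x^{\mathbf a}*\mathbf x^{\mathbf b}$. For a monomial $w=x_1^{a_1}\cdots x_n^{a_n}\neq 1$, $\max(w)=\max\{i\mid a_i>0\}$ and $\min(w)=\min\{i\mid a_i>0\}$; by convention $\max(1)=1$, $\min(1)=\infty$. A monomial ideal is a two-sided ideal of $R$ generated by monomials. A monomial ideal $I$ is stable if for every monomial $w\in I$ and every $i<\max(w)$, the monomial $\frac{x_i*w}{x_{\max(w)}}$ is in $I$. $G(I)$ denotes the unique minimal set of monomial generators of $I$ (no element is a proper multiple of another). If $I$ is stable, every monomial $w\in I$ has a unique canonical decomposition $w=u*y$ with $u\in G(I)$, $y\in X$, $\max(u)\le\min(y)$; put $g(w)=u$. The complex $L_\bullet(I)$: an admissible symbol is $e(\sigma;u)=e(i_1,\ldots,i_q;u)$ with $u\in G(I)$ and $\sigma=(i_1,\ldots,i_q)$ a strictly increasing sequence of integers with $1\le i_1<\cdots<i_q<\max(u)$ ($q\ge 0$). $L_q(I)$ is the free right $R$-module on the admissible symbols with $\sigma$ of length $q$. Write $\sigma_r=(i_1,\ldots,\widehat{i_r},\ldots,i_q)$, $x_\sigma=x_{i_1}\cdots x_{i_q}$ (so $x_\emptyset=1$), $u_r=g(x_{i_r}*u)$, and let $y_r$ be the monomial with $x_{i_r}*u=u_r*y_r$. Let $A(\sigma;u)$ be the set of $r\in\{1,\ldots,q\}$ such that $e(\sigma_r;u_r)$ is admissible. For $q\ge1$,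 the right $R$-linear map $d:L_q(I)\to L_{q-1}(I)$ is given by $$d(e(\sigma;u))=\sum_{r=1}^{q}(-1)^{r}e(\sigma_r;u)\,C(x_{\sigma_r}*u,x_{i_r})^{-1}x_{i_r}-\sum_{r\in A(\sigma;u)}(-1)^{r}e(\sigma_r;u_r)\,C(x_{\sigma_r},y_r)^{-1}y_r .$$ *)

(* Defs.v *)
From HB Require Import structures.
From mathcomp Require Import all_boot all_order all_algebra.
From mathcomp Require Import freeg mpoly.

Set Implicit Arguments.
Unset Strict Implicit.
Unset Printing Implicit Defensive.

Import GRing.Theory.
Local Open Scope ring_scope.

(* Variables are indexed by 'I_n, so x_1, ..., x_n are written
   x_0, ..., x_(n-1).  A monomial x^a is represented by its exponent
   vector a : 'X_{1..n}; thus * on monomials is (a + b)%MM and the quotient is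
   (a - b)%MM. *)

Definition is_ideal (k : comNzRingType) (J : k -> Prop) : Prop :=
  [/\ J 0, forall a b, J a -> J b -> J (a + b) & forall c a, J a -> J (c * a)].

Definition noetherian (k : comNzRingType) : Prop :=
  forall J : k -> Prop, is_ideal J ->
  exists m (s : 'I_m -> k),
    forall a, J a <-> exists c : 'I_m -> k, a = \sum_(i < m) c i * s i.

Definition ideal_gen (R : nzRingType) (S : R -> Prop) (f : R) : Prop :=
  exists m (a s b : 'I_m -> R),
    (forall i, S (s i)) /\ f = \sum_(i < m) a i * s i * b i.

(* A right R-module is a left module over the converse ring R^c. *)
Definition ract (R : nzRingType) (M : lmodType R^c) (z : M) (r : R) : M :=
  (r : R^c) *: z.

Definition mod_mul_ideal (R : nzRingType) (M : lmodType R^c) (J : R -> Prop)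
    (z : M) : Prop :=
  exists m (y : 'I_m -> M) (r : 'I_m -> R),
    (forall i, J (r i)) /\ z = \sum_(i < m) ract (y i) (r i).

Section FgLift.
Context (R : nzRingType) (K : choiceType) (M : lmodType R).

Lemma fglift_sumE (f : K -> M) (D : {freeg K / R}) :
  fglift f D = \sum_(x <- dom D) coeff x D *: f x.
Proof.
rewrite -[in LHS](Freeg_dom D) fglift_Freeg /prelift big_map.
by apply: eq_bigr.
Qed.

Lemma fglift_is_linear (f : K -> M) : linear (fglift f).
Proof.
have addl := lift_is_additive f.
have fD : {morph fglift f : x y / x + y}.
  move=> x y; have f0 : fglift f 0 = 0 by rewrite -(subrr 0) addl subrr.
  by rewrite -{1}[y]opprK addl -(sub0r y) addl f0 sub0r opprK.
move=> c D E; rewrite fD; congr (_ + _).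
elim/freeg_ind_dom0: D => [|a x D _ _ IH].
  have f0 : fglift f 0 = 0 by rewrite -(subrr 0) addl subrr.
  by rewrite scaler0 f0 scaler0.
rewrite scalerDr !fD IH scalerDr; congr (_ + _).
have -> : c *: << a *g x >> = << c * a *g x >> :> {freeg K / R}.
  by apply/eqP/freeg_eqP => y; rewrite coeffZ !coeffU mulrA.
by rewrite !liftU scalerA.
Qed.
HB.instance Definition _ (f : K -> M) :=
  GRing.isLinear.Build R {freeg K / R} M _ (fglift f) (fglift_is_linear f).

End FgLift.

Section SkewPoly.
Context (k : comUnitRingType) (n : nat).

Definition skew_param (q : 'M[k]_n) : Prop :=
  [/\ forall i j, q i j \is a GRing.unit,
      forall i, q i i = 1
    & forall i j, q j i = (q i j)^-1].

(* x^a x^b = skewC a b x^(a+b): moving x_j leftwards past x_i, for j < i,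
   produces a factor q i j; see mono_mul below. *)
Definition skewC (q : 'M[k]_n) (a b : 'X_{1..n}) : k :=
  \prod_(i < n) \prod_(j < n | (j < i)%N) q i j ^+ (a i * b j).

(* The skew polynomial ring: the free k-module on the monomials with
   multiplication x^a x^b = skewC a b x^(a+b).  By scaleAl_skew, scaleAr_skew,
   var_comm and mono_prod it is the k-algebra (k central) with
   x_i x_j = q_ij x_j x_i having the monomials x_0^a_0 ... x_(n-1)^a_(n-1)
   as a k-basis, i.e. the iterated Ore extension. *)
Definition skewpoly (q : 'M[k]_n) : Type := {freeg 'X_{1..n} / k}.

Variable q : 'M[k]_n.
HB.instance Definition _ := GRing.Lmodule.copy (skewpoly q) {freeg 'X_{1..n} / k}.

Definition mono (a : 'X_{1..n}) : skewpoly q := << a >>.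
Definition var (i : 'I_n) : skewpoly q := mono U_(i).

Definition skewpoly_mul (f g : skewpoly q) : skewpoly q :=
  fglift (fun a => fglift (fun b => skewC q a b *: mono (a + b)%MM) g) f.

Local Notation "f *s g" := (skewpoly_mul f g) (at level 40).

Lemma skewpoly_ind (P : skewpoly q -> Prop) :
  P 0 -> (forall c a f, P f -> P (c *: mono a + f)) -> forall f, P f.
Proof.
move=> P0 PS; elim/freeg_ind_dom0 => // c a f _ _ Pf.
have -> : << c *g a >> = c *: << a >> :> {freeg 'X_{1..n} / k}.
  by apply/eqP/freeg_eqP => y; rewrite coeffZ !coeffU mul1r.
exact: PS.
Qed.

Lemma fglift_mono (F : 'X_{1..n} -> skewpoly q) a : fglift F (mono a) = F a.
Proof. by rewrite liftU scale1r. Qed.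

Lemma smul_linl c f1 f2 g : (c *: f1 + f2) *s g = c *: (f1 *s g) + f2 *s g.
Proof. exact: linearP. Qed.

Lemma smul_linr c f g1 g2 : f *s (c *: g1 + g2) = c *: (f *s g1) + f *s g2.
Proof.
elim/skewpoly_ind: f => [|e a f IH].
  by rewrite /skewpoly_mul !linear0 addr0.
rewrite !smul_linl IH; rewrite /skewpoly_mul !fglift_mono linearP.
by rewrite !scalerDr !scalerA mulrC addrACA.
Qed.

Lemma smul0l g : 0 *s g = 0. Proof. exact: linear0. Qed.
Lemma smul0r f : f *s 0 = 0.
Proof. by have := smul_linr (-1) f 0 0; rewrite scaler0 addr0 scaleN1r addNr. Qed.

Lemma smul_mono a b : mono a *s mono b = skewC q a b *: mono (a + b)%MM.
Proof. by rewrite /skewpoly_mul !fglift_mono. Qed.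

Lemma smulZl c f g : (c *: f) *s g = c *: (f *s g).
Proof. by have := smul_linl c f 0 g; rewrite smul0l !addr0. Qed.
Lemma smulZr c f g : f *s (c *: g) = c *: (f *s g).
Proof. by have := smul_linr c f g 0; rewrite smul0r !addr0. Qed.
Lemma smulDl : left_distributive skewpoly_mul +%R.
Proof. by move=> f g h; have := smul_linl 1 f g h; rewrite !scale1r. Qed.
Lemma smulDr : right_distributive skewpoly_mul +%R.
Proof. by move=> f g h; have := smul_linr 1 f g h; rewrite !scale1r. Qed.

Lemma skewCDl a a' b : skewC q (a + a')%MM b = skewC q a b * skewC q a' b.
Proof.
rewrite /skewC -big_split; apply: eq_bigr => i _; rewrite -big_split.
by apply: eq_bigr => j _; rewrite mnmDE mulnDl exprD.
Qed.

Lemma skewCDr a b b' : skewC q a (b + b')%MM = skewC q a b * skewC q a b'.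
Proof.
rewrite /skewC -big_split; apply: eq_bigr => i _; rewrite -big_split.
by apply: eq_bigr => j _; rewrite mnmDE mulnDr exprD.
Qed.

Lemma skewC_eq1 (a b : 'X_{1..n}) :
  (forall i j : 'I_n, (j < i)%N -> (a i * b j = 0)%N) -> skewC q a b = 1.
Proof. by move=> h; apply: big1 => i _; apply: big1 => j /h ->. Qed.

Lemma smul1l : left_id (mono 0%MM) skewpoly_mul.
Proof.
elim/skewpoly_ind => [|c a f IH]; first by rewrite smul0r.
rewrite smul_linr IH smul_mono add0m skewC_eq1 ?scale1r // => i j _.
by rewrite mnm0E.
Qed.

Lemma smul1r : right_id (mono 0%MM) skewpoly_mul.
Proof.
elim/skewpoly_ind => [|c a f IH]; first by rewrite smul0l.
rewrite smul_linl IH smul_mono addm0 skewC_eq1 ?scale1r // => i j _.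
by rewrite mnm0E muln0.
Qed.

Lemma smulA : associative skewpoly_mul.
Proof.
move=> f g h.
elim/skewpoly_ind: f => [|c a f IHf]; first by rewrite !smul0l.
rewrite !smul_linl -IHf; congr (_ *: _ + _) => {IHf}.
elim/skewpoly_ind: g => [|d b g IHg]; first by rewrite ?smul0l !smul0r ?smul0l.
rewrite smul_linl !smul_linr smul_linl -IHg; congr (_ *: _ + _) => {IHg}.
elim/skewpoly_ind: h => [|e m h IHh]; first by rewrite !smul0r.
rewrite !smul_linr -IHh; congr (_ *: _ + _) => {IHh}.
rewrite !smul_mono smulZl smulZr !smul_mono !scalerA addmA skewCDl skewCDr.
by congr (_ *: _); rewrite mulrC mulrA.
Qed.

Lemma mono0_neq0 : mono 0%MM != 0.
Proof. by rewrite /mono freegU_eq0 oner_eq0. Qed.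

HB.instance Definition _ := GRing.Zmodule_isNzRing.Build (skewpoly q)
  smulA smul1l smul1r smulDl smulDr mono0_neq0.

Lemma scaleAl_skew (c : k) (f g : skewpoly q) : c *: (f * g) = c *: f * g.
Proof. by symmetry; apply: smulZl. Qed.
HB.instance Definition _ :=
  GRing.Lmodule_isLalgebra.Build k (skewpoly q) scaleAl_skew.

Lemma scaleAr_skew (c : k) (f g : skewpoly q) : c *: (f * g) = f * (c *: g).
Proof. by symmetry; apply: smulZr. Qed.
HB.instance Definition _ :=
  GRing.Lalgebra_isAlgebra.Build k (skewpoly q) scaleAr_skew.

Lemma mono_mul a b : mono a * mono b = skewC q a b *: mono (a + b)%MM.
Proof. exact: smul_mono. Qed.

Lemma mono0 : mono 0%MM = 1. Proof. by []. Qed.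

Lemma skewC_unit a b : skew_param q -> skewC q a b \is a GRing.unit.
Proof.
case=> qU _ _; apply: rpred_prod => i _; apply: rpred_prod => j _.
exact: rpredX.
Qed.

Lemma skewC_var (i j : 'I_n) :
  skewC q U_(i) U_(j) = if (j < i)%N then q i j else 1.
Proof.
rewrite /skewC (bigD1 i) //= [X in _ * X]big1 => [|l li].
  rewrite mulr1 big_mkcond (bigD1 j) //= [X in _ * X]big1 => [|l lj].
    by rewrite !mnm1E !eqxx mulr1; case: ifP => // _; rewrite expr1.
  by case: ifP => // _; rewrite !mnm1E eqxx [j == l]eq_sym (negPf lj).
by apply: big1 => m _; rewrite !mnm1E eq_sym (negPf li).
Qed.

Lemma var_comm (i j : 'I_n) : skew_param q ->
  var i * var j = q i j *: (var j * var i).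
Proof.
case=> qU q1 qV; rewrite !mono_mul scalerA addmC !skewC_var.
case: (ltngtP i j) => [||/val_inj->]; rewrite ?mulr1 ?q1 // => _.
by rewrite (qV i j) mulrV.
Qed.

Lemma var_exp (i : 'I_n) e : var i ^+ e = mono (U_(i) *+ e)%MM.
Proof.
elim: e => [|e IH]; first by rewrite mulm0n.
rewrite exprS IH mono_mul mulmS skewC_eq1 ?scale1r // => u v vu.
rewrite mulmnE !mnm1E; case: (i =P u) => [Eu|//]; case: (i =P v) => [Ev|//].
by move: vu; rewrite -Eu -Ev ltnn.
Qed.

Lemma mono_prod a : mono a = \prod_(i < n) var i ^+ a i.
Proof.
have srt : sorted (fun i j : 'I_n => (i < j)%N) (index_enum 'I_n).
  rewrite /index_enum -enumT -(@sorted_map _ _ val ltn) val_enum_ord.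
  exact: iota_ltn_sorted.
rewrite {1}(multinomUE_id a).
have ltT : transitive (fun i j : 'I_n => (i < j)%N) by move=> x y z; apply: ltn_trans.
elim: (index_enum _) srt => [|i s IH]; first by rewrite !big_nil.
rewrite /= (path_sortedE ltT) => /andP[/allP lti /IH{}IH].
rewrite !big_cons var_exp -IH mono_mul skewC_eq1 ?scale1r // => u v vu.
rewrite mulmnE mnm1E; case: eqP => [E|//]; rewrite mnm_sumE big1_seq ?muln0 //.
move=> w /andP[_ /lti iw]; rewrite mulmnE mnm1E.
case: (w =P v) => [F|//]; rewrite F in iw.
by have := ltn_trans iw vu; rewrite E ltnn.
Qed.

End SkewPoly.

Arguments mono {k n} q a.
Arguments var {k n} q i.

Section StableIdeals.
Context (k : comUnitRingType) (n : nat) (q : 'M[k]_n).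
Implicit Types (I : skewpoly q -> Prop) (G : {pred 'X_{1..n}}).

Definition mono_ideal (S : 'X_{1..n} -> Prop) : skewpoly q -> Prop :=
  ideal_gen (fun f => exists2 a, S a & f = mono q a).

Definition monomial_ideal I : Prop :=
  exists S : 'X_{1..n} -> Prop, forall f, I f <-> mono_ideal S f.

(* max(w), as a 1-based index, with max(1) = 1. *)
Definition mmax (w : 'X_{1..n}) : nat :=
  maxn 1 (\max_(i < n | (0 < w i)%N) i.+1).

(* max(u) <= min(y), with min(1) = infinity. *)
Definition max_le_min (u y : 'X_{1..n}) : bool :=
  [forall i : 'I_n, (0 < y i)%N ==> (mmax u <= i.+1)%N].

(* j is the 0-based index of the last variable of w. *)
Definition stable I : Prop :=
  monomial_ideal I /\
  forall (w : 'X_{1..n}) (i j : 'I_n),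
    I (mono q w) -> mmax w = j.+1 -> (i < j)%N ->
    I (mono q (U_(i) + w - U_(j))%MM).

(* G = G(I): a generating set no element of which properly divides another. *)
Definition minimal_generators I G : Prop :=
  (forall f, I f <-> mono_ideal (fun a => a \in G) f) /\
  (forall u v, u \in G -> v \in G -> (u <= v)%MM -> u = v).

Definition canonical_factor G (w u : 'X_{1..n}) : bool :=
  [&& u \in G, (u <= w)%MM & max_le_min u (w - u)%MM].

(* g(w); the default value 0 is never used on monomials of a stable ideal. *)
Definition gfun G (w : 'X_{1..n}) : 'X_{1..n} :=
  if [pick u : 'X_{1..n < (mdeg w).+1} | canonical_factor G w u] is Some u
  then val u else 0%MM.

End StableIdeals.

Section Complex.
Context (k : comUnitRingType) (n : nat) (q : 'M[k]_n) (G : {pred 'X_{1..n}}).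
Local Notation R := (skewpoly q).

Definition admissible p (s : p.-tuple 'I_n * 'X_{1..n}) : bool :=
  [&& s.2 \in G, sorted ltn [seq val i | i <- s.1]
    & all (fun i : 'I_n => i.+1 < mmax s.2)%N s.1].

Definition symbol p : Type := {s : p.-tuple 'I_n * 'X_{1..n} | admissible s}.
HB.instance Definition _ p := Choice.on (symbol p).

Definition L p : lmodType R^c := {freeg (symbol p) / R^c}.

(* e(sigma; u), and 0 when it is not admissible. *)
Definition ebasis p (sigma : p.-tuple 'I_n) (u : 'X_{1..n}) : L p :=
  if insub (sigma, u) is Some s then << s >> else 0.

Definition drop_nth p (sigma : p.+1.-tuple 'I_n) (r : 'I_p.+1) : p.-tuple 'I_n :=
  [tuple tnth sigma (fintype.lift r l) | l < p].

Definition xprod p (sigma : p.-tuple 'I_n) : 'X_{1..n} :=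
  (\sum_(i <- sigma) U_(i))%MM.

(* r : 'I_p.+1 is 0-based, hence the signs (-1)^(r+1). *)
Definition d_basis p (s : symbol p.+1) : L p :=
  let: (sigma, u) := val s in
  let i_ r := tnth sigma r in
  let sigma_ r := drop_nth sigma r in
  let w_ r := (U_(i_ r) + u)%MM in
  let u_ r := gfun G (w_ r) in
  let y_ r := (w_ r - u_ r)%MM in
  \sum_(r < p.+1)
     ract (ebasis (sigma_ r) u)
          ((-1) ^+ r.+1 *:
             ((skewC q (xprod (sigma_ r) + u)%MM U_(i_ r))^-1 *: var q (i_ r)))
  - \sum_(r < p.+1 | admissible (sigma_ r, u_ r))
     ract (ebasis (sigma_ r) (u_ r))
          ((-1) ^+ r.+1 *:
             ((skewC q (xprod (sigma_ r)) (y_ r))^-1 *: mono q (y_ r))).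

Definition d p : L p.+1 -> L p := fglift (@d_basis p).
HB.instance Definition _ p := GRing.Linear.on (@d p).

Definition eps : L 0 -> R := fglift (fun s => mono q (val s).2 : (R^c)^o).

Definition free_resolution (I : R -> Prop) : Prop :=
  [/\ forall f, I f <-> exists z, eps z = f,
      forall z, eps z = 0 <-> exists y, @d 0 y = z
    & forall p z, @d p z = 0 <-> exists y, @d p.+1 y = z].

Definition irrelevant_ideal : R -> Prop :=
  ideal_gen (fun f => exists i, f = var q i).

Definition minimal_differential : Prop :=
  forall p (z : L p.+1), mod_mul_ideal irrelevant_ideal (@d p z).

End Complex.

Arguments L {k n} q G p.
Arguments d {k n} q G {p}.
Arguments eps {k n} q G.

(* Main.v *)
(* R is a cocycle twist of the commutative polynomial ring: multiplying the
   elements e(sigma;u) x^c by suitable units of k gives a k-basis E(sigma,u,c)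
   of the free modules on which d acts without coefficients,
     E(sigma,u,c) |-> sum_r (-1)^r (E(sigma_r, u, c x_r) - E(sigma_r, u_r, c y_r)),
   with E = 0 on non-admissible symbols.  Since g(x_i * g(w)) = g(x_i * w), the
   operators u |-> u x_i and u |-> g(x_i * u) y commute, whence d^2 = 0.
   For exactness, d = d' + d'' where d' is a sum of Koszul differentials, one
   for each u, and d'' replaces u by the strictly lexicographically larger
   monomial u_r.  The Koszul part has an explicit contracting homotopy h (move
   the first variable of c into sigma), so 1 - dh - hd is locally nilpotent in
   positive degrees, because each multidegree involves finitely many u; in
   degree zero the same reduction leads to the canonical decompositions, which
   form a k-basis of I. *)
Require Import Defs.
From HB Require Import structures.
From mathcomp Require Import all_boot all_order all_algebra.
From mathcomp Require Import freeg mpoly.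
From mathcomp Require Import zify.

Set Implicit Arguments.
Unset Strict Implicit.
Unset Printing Implicit Defensive.

Import GRing.Theory.
Local Open Scope ring_scope.

(** * Canonical decompositions *)

Section MonomialCombinatorics.
Context (n : nat) (G : {pred 'X_{1..n}}).
Implicit Types (u v w y : 'X_{1..n}) (i j l : 'I_n).

Lemma mmax_gt0 w : (0 < mmax w)%N.
Proof. by rewrite leq_max. Qed.

(** [mmax] counts from 1 while variables count from 0, so x_i with i < m is a bound by m; the value
    1 at the monomial 1 is why m must be positive. *)
Lemma mmax_leP w m :
  (0 < m)%N -> reflect (forall i, (0 < w i)%N -> (i < m)%N) (mmax w <= m)%N.
Proof. by move=> m0; rewrite geq_max m0; apply: bigmax_leqP. Qed.

Lemma ltn_mmax w i : (0 < w i)%N -> (i < mmax w)%N.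
Proof. by move: i; apply/mmax_leP => //; apply: mmax_gt0. Qed.

Lemma mmax_attained w : w != 0%MM -> exists2 j : 'I_n, mmax w = j.+1 & (0 < w j)%N.
Proof.
move=> w0; have [i wi] : exists i, (0 < w i)%N.
  apply/existsP; apply: contraNT w0 => /existsPn w0; apply/eqP/mnmP => i.
  by rewrite mnm0E; apply/eqP; rewrite -leqn0 leqNgt.
case: (@eq_bigmax_cond _ [pred j : 'I_n | (0 < w j)%N] (fun j : 'I_n => j.+1)).
  by apply/card_gt0P; exists i.
move=> j wj E; exists j => //; rewrite /mmax; move: E => /= ->.
by rewrite maxnE subn1 /= add1n.
Qed.

Lemma mmax_le u w : (u <= w)%MM -> (mmax u <= mmax w)%N.
Proof.
move/mnm_lepP=> uw; apply/(mmax_leP _ (mmax_gt0 _)) => i ui.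
by apply: ltn_mmax; apply: leq_trans (uw i).
Qed.

Lemma max_le_minP u y :
  reflect (forall i, (0 < y i)%N -> (mmax u <= i.+1)%N) (max_le_min u y).
Proof.
apply: (iffP forallP) => h i; last exact/implyP/h.
by move: (h i) => /implyP.
Qed.

(** Membership of x^w in the ideal generated by G. Divisors of w have degree at most that of w, so a
    bounded search makes this a boolean. *)
Definition up w : bool :=
  [exists u : 'X_{1..n < (mdeg w).+1}, (bmnm u \in G) && (bmnm u <= w)%MM].

Lemma mdeg_le u w : (u <= w)%MM -> (mdeg u <= mdeg w)%N.
Proof. by move/submK=> <-; rewrite mdegD leq_addl. Qed.

Lemma upP w : reflect (exists2 u, u \in G & (u <= w)%MM) (up w).
Proof.
apply: (iffP existsP) => [[u /andP[uG uw]]|[u uG uw]]; first by exists (bmnm u).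
have du : (mdeg u < (mdeg w).+1)%N by rewrite ltnS mdeg_le.
by exists (BMultinom du); rewrite /= uG uw.
Qed.

Lemma up_le w w' : (w <= w')%MM -> up w -> up w'.
Proof.
move=> ww' /upP[u uG uw]; apply/upP; exists u => //.
exact: lepm_trans ww'.
Qed.

Lemma up_gen u : u \in G -> up u.
Proof. by move=> uG; apply/upP; exists u => //; apply: lepm_refl. Qed.

(** The combinatorial content of stability and minimality, stated for exponents only, so that
    canonical decompositions can be studied without the ring. *)
Definition stable_antichain : Prop :=
  (forall u v, u \in G -> v \in G -> (u <= v)%MM -> u = v) /\
  (forall w i j, up w -> mmax w = j.+1 -> (i < j)%N -> up (U_(i) + w - U_(j))%MM).

Context (GP : stable_antichain).
Let Gmin := GP.1.

(* The shortest prefix of w, in increasing order of the variables, that lies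
   in the ideal is a minimal generator. *)
Lemma canonical_factor_exists w : up w -> exists u, canonical_factor G w u.
Proof.
have [m] := ubnP (mdeg w); elim: m w => // m IH w; rewrite ltnS => wm wU.
have [wG|wG] := boolP (w \in G).
  exists w; rewrite /canonical_factor wG lepm_refl /=.
  by apply/max_le_minP => i; rewrite mnmBE subnn.
have [u uG uw] := upP w wU.
have neq_uw : u != w by apply: contraNneq wG => <-.
have w0 : w != 0%MM.
  apply: contraNneq neq_uw => w0; rewrite w0 in uw *; apply/eqP/mnmP => i.
  by apply/eqP; rewrite mnm0E -leqn0; move/mnm_lepP: uw => /(_ i); rewrite mnm0E.
have [j wj wj0] := mmax_attained w0.
have w'w : (w - U_(j) <= w)%MM by apply: lem_subr.
have w'U : up (w - U_(j))%MM.
  move/mnm_lepP: (uw) => le_uw.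
  have [ujw|] := ltnP (u j) (w j).
    apply/upP; exists u => //; apply/mnm_lepP => i; rewrite mnmBE mnm1E.
    by have := le_uw i; case: eqP => [<-|_] /=; lia.
  (* Here u uses up the whole power of x_j in w, so x_j is also its last variable. Some earlier x_i
     has room left in w, and by stability x_i * u / x_j lies in the ideal; it divides w / x_j. *)
  move=> wju; have uj : u j = w j by apply/eqP; rewrite eqn_leq le_uw.
  have mu : mmax u = j.+1.
    by apply/eqP; rewrite eqn_leq -{1}wj mmax_le //= ltn_mmax // uj.
  have [i uwi] : exists i, (u i < w i)%N.
    apply/existsP; apply: contraNT neq_uw => /existsPn h; apply/eqP/mnmP => i.
    by apply/eqP; rewrite eqn_leq le_uw leqNgt h.
  have ij : (i < j)%N.
    have : (i < j.+1)%N by rewrite -wj ltn_mmax //; lia.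
    rewrite ltnS leq_eqVlt => /orP[/eqP/val_inj Eij|//].
    by rewrite Eij uj ltnn in uwi.
  apply: up_le _ (GP.2 _ _ _ (up_gen uG) mu ij); apply/mnm_lepP => l.
  rewrite !mnmBE !mnmDE !mnm1E; have := le_uw l.
  by have [<-|] := eqVneq i l; have [_|] := eqVneq j _; rewrite ?mnmE /=; lia.
have [|u' /and3P[u'G u'w' /max_le_minP h]] := IH _ _ w'U.
  have := submK (m := U_(j)%MM) (m' := w); rewrite lep1mP -lt0n => /(_ wj0) E.
  by rewrite -E mdegD mdeg1 in wm; lia.
exists u'; have u'w := lepm_trans u'w' w'w.
rewrite /canonical_factor u'G u'w; apply/max_le_minP => i.
rewrite mnmBE => hi; have [<-|ji] := eqVneq j i.
  by rewrite -wj mmax_le.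
by apply: h; rewrite !mnmBE mnm1E (negPf ji) subn0.
Qed.

(** If neither factor divides the other, some x_i occurs more often in u and some x_j more often in
    v. Then x_i divides w / v and x_j divides w / u, so max(v) is at most i and max(u) at most j
    (0-based). This forces i = j, a contradiction. *)
Lemma canonical_factor_unique w u v :
  canonical_factor G w u -> canonical_factor G w v -> u = v.
Proof.
move=> /and3P[uG /mnm_lepP uw /max_le_minP hu] /and3P[vG /mnm_lepP vw /max_le_minP hv].
have [|/mnm_lepP nuv] := boolP (u <= v)%MM; first exact: Gmin.
have [|/mnm_lepP nvu] := boolP (v <= u)%MM; first by move/Gmin=> ->.
have ex (a b : 'X_{1..n}) : ~ (forall i, (a i <= b i)%N) -> exists i, (b i < a i)%N.
  move=> h; apply/existsP; apply: contraT => /existsPn g; case: h => i.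
  by rewrite leqNgt g.
have [i vui] := ex _ _ nuv; have [j uvj] := ex _ _ nvu.
have i1 : (i < mmax u)%N by apply: ltn_mmax; lia.
have j1 : (j < mmax v)%N by apply: ltn_mmax; lia.
have i2 : (mmax v <= i.+1)%N by apply: hv; rewrite mnmBE; have := uw i; lia.
have j2 : (mmax u <= j.+1)%N by apply: hu; rewrite mnmBE; have := vw j; lia.
have Eij : i = j by apply: val_inj => /=; lia.
by move: uvj; rewrite -Eij; lia.
Qed.

Lemma gfunP w : up w -> canonical_factor G w (gfun G w).
Proof.
move=> /canonical_factor_exists[u cu]; rewrite /gfun; case: pickP => [v //|].
have du : (mdeg u < (mdeg w).+1)%N by rewrite ltnS mdeg_le //; case/and3P: cu.
by move/(_ (BMultinom du)); rewrite /= cu.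
Qed.

Lemma gfun_eq w u : canonical_factor G w u -> gfun G w = u.
Proof.
move=> cu; apply: (@canonical_factor_unique w) => //; apply: gfunP.
by apply/upP; exists u; case/and3P: cu.
Qed.

Lemma gfun_in w : up w -> gfun G w \in G.
Proof. by case/gfunP/and3P. Qed.

Lemma gfun_le w : up w -> (gfun G w <= w)%MM.
Proof. by case/gfunP/and3P. Qed.

Lemma gfun_max_le_min w i :
  up w -> (gfun G w i < w i)%N -> (mmax (gfun G w) <= i.+1)%N.
Proof.
by move=> /gfunP/and3P[_ _ /max_le_minP h] lt_gw; apply: h; rewrite mnmBE subn_gt0.
Qed.

Lemma gfun_gen u : u \in G -> gfun G u = u.
Proof.
move=> uG; apply: gfun_eq; rewrite /canonical_factor uG lepm_refl.
by apply/max_le_minP => i; rewrite mnmBE subnn.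
Qed.

Lemma up_var i w : up w -> up (U_(i) + w)%MM.
Proof. by apply: up_le; apply: lem_addl. Qed.

(** If the maximum grew, no variable of g(w) could occur in the quotient of x_i * w by g(x_i * w).
    Then g(w) would divide g(x_i * w), and minimality would make them equal. *)
Lemma mmax_gfun_var i w :
  up w -> (mmax (gfun G (U_(i) + w)%MM) <= mmax (gfun G w))%N.
Proof.
move=> wU; have xU := up_var i wU; rewrite leqNgt; apply/negP => lt_max.
suff E : gfun G w = gfun G (U_(i) + w)%MM by rewrite -E ltnn in lt_max.
apply: Gmin; rewrite ?gfun_in //; apply/mnm_lepP => l.
case: (posnP (gfun G w l)) => [->//|/ltn_mmax lg].
have /mnm_lepP/(_ l) := gfun_le wU.
have := @gfun_max_le_min (U_(i) + w)%MM l xU; rewrite mnmDE.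
case: (ltnP (gfun G (U_(i) + w)%MM l)) => [_ /(_ isT)|]; lia.
Qed.

(** The quotient of x_i * w by g(x_i * g(w)) is that of x_i * g(w) times w / g(w). The variables of
    the second factor start no earlier than max(g(w)), which bounds the maximum of g(x_i * g(w)). *)
Lemma gfun_var_gfun i w :
  up w -> gfun G (U_(i) + gfun G w)%MM = gfun G (U_(i) + w)%MM.
Proof.
move=> wU; have gU := up_gen (gfun_in wU); have xU := up_var i gU.
symmetry; apply: gfun_eq; rewrite /canonical_factor gfun_in //=.
have /mnm_lepP le_g := gfun_le wU; have /mnm_lepP le_xg := gfun_le xU.
apply/andP; split.
  apply/mnm_lepP => l; have := le_g l; have := le_xg l.
  by rewrite !mnmDE; lia.
apply/max_le_minP => l; rewrite mnmBE mnmDE.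
have := mmax_gfun_var i gU; rewrite (gfun_gen (gfun_in wU)) => mg hl.
have [/(gfun_max_le_min wU)|wl] := ltnP (gfun G w l) (w l); first by lia.
by apply: gfun_max_le_min => //; rewrite mnmDE; lia.
Qed.

Lemma gfun_var_gen u i : u \in G -> (mmax u <= i.+1)%N -> gfun G (U_(i) + u)%MM = u.
Proof.
move=> uG ui; apply: gfun_eq; rewrite /canonical_factor uG lem_addl /= addmK.
by apply/max_le_minP => j; rewrite mnm1E; case: eqP => [<-|].
Qed.

(** Otherwise x_i * u would be a minimal generator properly divisible by u. Hence y_r is never 1,
    which gives the minimality of the resolution. *)
Lemma gfun_var_neq u i : u \in G -> gfun G (U_(i) + u)%MM != (U_(i) + u)%MM.
Proof.
move=> uG; apply/eqP => E.
have := gfun_in (up_var i (up_gen uG)); rewrite E => xG.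
have /mnmP/(_ i) := Gmin uG xG (lem_addl _ _).
by rewrite mnmDE mnm1E eqxx; lia.
Qed.

(** * The lexicographic order on monomials *)

Definition lexlt u v : bool :=
  [exists i : 'I_n, (u i < v i)%N && [forall j : 'I_n, (j < i)%N ==> (u j == v j)]].

Lemma lexlt_irr u : ~~ lexlt u u.
Proof. by apply/existsPn => i; rewrite ltnn. Qed.

Lemma lexlt_trans : transitive lexlt.
Proof.
move=> v u w /existsP[i /andP[uvi /forallP hi]] /existsP[j /andP[vwj /forallP hj]].
apply/existsP; have [ij|ji|/val_inj Eij] := ltngtP i j.
- exists i; have := hj i; rewrite ij => /eqP <-; rewrite uvi /=.
  apply/forallP => l; apply/implyP => li; have := hi l; rewrite li => /eqP ->.
  by have := hj l; rewrite (ltn_trans li ij).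
- exists j; have := hi j; rewrite ji => /eqP ->; rewrite vwj /=.
  apply/forallP => l; apply/implyP => lj; have := hi l.
  by rewrite (ltn_trans lj ji) => /eqP ->; have := hj l; rewrite lj.
- exists i; rewrite -Eij in vwj hj; rewrite (ltn_trans uvi vwj) /=.
  apply/forallP => l; apply/implyP => li; have := hi l; rewrite li => /eqP ->.
  by have := hj l; rewrite li.
Qed.

(** Put v = g(x_i * u). If v did not contain the added x_i it would divide u, hence equal u, with
    quotient x_i before max(u). So v gains x_i, and variables before x_i cannot be in the quotient,
    so their exponents stay unchanged. *)
Lemma lexlt_gfun_var u i :
  u \in G -> (i.+1 < mmax u)%N -> lexlt u (gfun G (U_(i) + u)%MM).
Proof.
move=> uG iu; have xU := up_var i (up_gen uG).
have /mnm_lepP le_xg := gfun_le xU; set v := gfun _ _ in le_xg *.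
have uvi : (u i < v i)%N.
  rewrite ltnNge; apply/negP => vui.
  have E : v = u.
    apply: Gmin; rewrite ?gfun_in //; apply/mnm_lepP => j.
    by have := le_xg j; rewrite mnmDE mnm1E; case: eqP => [<-|].
  have := @gfun_max_le_min _ i xU; rewrite -/v E mnmDE mnm1E eqxx.
  by rewrite add1n leqnn leqNgt iu => /(_ isT).
apply/existsP; exists i; rewrite uvi /=; apply/forallP => j; apply/implyP => ji.
have := le_xg j; have := @gfun_max_le_min _ j xU; rewrite -/v mnmDE mnm1E.
have -> : (i == j) = false by apply/negP => /eqP E; rewrite E ltnn in ji.
have iv : (i < mmax v)%N by apply: ltn_mmax; lia.
rewrite add0n eqn_leq => h ->; rewrite andbT leqNgt; apply/negP => /h; lia.
Qed.

End MonomialCombinatorics.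

(** * Right modules over the skew polynomial ring *)

(** The pairs (r, s) and (s+1, r) carry opposite signs. In the induction the last row cancels the
    last column. *)
Lemma alternating_double_sum (A : nzRingType) (V : lmodType A) m (f : nat -> nat -> V) :
  (forall r s, (r <= s)%N -> (s < m)%N -> f r s = f s.+1 r) ->
  \sum_(r < m.+1) \sum_(s < m) (-1) ^+ r *: ((-1) ^+ s *: f r s) = 0.
Proof.
elim: m => [|m IH] fS; first by rewrite big1 // => r _; rewrite big_ord0.
rewrite big_ord_recr /=; under eq_bigr do rewrite big_ord_recr /=.
rewrite big_split /= IH ?add0r; last by move=> r s rs sm; apply: fS; lia.
rewrite -big_split big1 // => r _ /=.
rewrite (fS r m) ?leq_ord // !scalerA -!exprD addSn exprS mulN1r scaleNr addnC.
exact: subrr.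
Qed.

(** * Additive maps on free modules *)

Section AdditiveExtension.
Context (A : nzRingType) (K : choiceType) (V : zmodType) (g : K -> A -> V).
Context (gD : forall s, {morph g s : x y / x + y}).

(** In contrast to [fglift], each coefficient passes through a merely additive map; the homotopy
    below is k-linear but not R-linear. *)
Definition additive_ext (D : {freeg K / A}) : V := \sum_(s <- dom D) g s (coeff s D).

Lemma additive_ext0r s : g s 0 = 0.
Proof. by apply: (addrI (g s 0)); rewrite -gD !addr0. Qed.

Lemma additive_ext_sub r (D : {freeg K / A}) :
  uniq r -> {subset dom D <= r} -> additive_ext D = \sum_(s <- r) g s (coeff s D).
Proof.
move=> Ur sDr; rewrite (bigID (mem (dom D))) /= [X in _ + X]big1 => [|s sD].
  rewrite addr0 -big_filter; apply/perm_big/uniq_perm; rewrite ?uniq_dom ?filter_uniq //.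
  by move=> s; rewrite mem_filter /=; case: (boolP (s \in dom D)) => // /sDr ->.
by rewrite coeff_outdom // additive_ext0r.
Qed.

Lemma additive_extD : {morph additive_ext : x y / x + y}.
Proof.
move=> x y; pose r := undup (dom x ++ dom y).
have Ur : uniq r by apply: undup_uniq.
rewrite !(@additive_ext_sub r) //.
- by rewrite -big_split; apply: eq_bigr => s _; rewrite coeffD gD.
- by move=> s; rewrite mem_undup mem_cat orbC => ->.
- by move=> s; rewrite mem_undup mem_cat => ->.
- by move=> s /domD_subset; rewrite mem_undup.
Qed.

Lemma additive_extU a s : additive_ext << a *g s >> = g s a.
Proof.
rewrite (@additive_ext_sub [:: s]) //; first by rewrite big_seq1 coeffU eqxx mulr1.
by move=> t; rewrite mem_dom coeffU mem_seq1 [t == s]eq_sym; case: (s == t); rewrite ?mulr0 ?eqxx.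
Qed.
End AdditiveExtension.

Section RightModules.
Context (k : comUnitRingType) (n : nat) (q : 'M[k]_n).
Local Notation R := (skewpoly q).
Implicit Types (M : lmodType R^c) (c : k) (r s : R).

Lemma ract_ract M (z : M) r s : ract (ract z r) s = ract z (r * s).
Proof. by rewrite /ract scalerA. Qed.

Lemma ractDl M (y z : M) r : ract (y + z) r = ract y r + ract z r.
Proof. exact: scalerDr. Qed.

Lemma ractDr M (z : M) r s : ract z (r + s) = ract z r + ract z s.
Proof. exact: scalerDl. Qed.

Lemma ract0r M (z : M) : ract z (0 : R) = 0.
Proof. exact: scale0r. Qed.

Lemma ract0l M (r : R) : ract (0 : M) r = 0.
Proof. exact: scaler0. Qed.

Lemma ract1 M (z : M) : ract z (1 : R) = z.
Proof. exact: scale1r. Qed.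

(** The modules carry only the right action of R; k acts through the central elements c 1, so this
    action commutes with [ract]. *)
Definition kscal M c (z : M) : M := ract z (c%:A : R).

Lemma ractZ M (z : M) c r : ract z (c *: r) = kscal c (ract z r).
Proof. by rewrite /kscal ract_ract -scalerAr mulr1. Qed.

Lemma ract_kscal M (z : M) c r : ract (kscal c z) r = kscal c (ract z r).
Proof. by rewrite /kscal !ract_ract -scalerAr mulr1 -scalerAl mul1r. Qed.

Lemma kscalDr M c (y z : M) : kscal c (y + z) = kscal c y + kscal c z.
Proof. exact: ractDl. Qed.

Lemma kscalDl M c e (z : M) : kscal (c + e) z = kscal c z + kscal e z.
Proof. by rewrite /kscal scalerDl ractDr. Qed.

Lemma kscalA M c e (z : M) : kscal c (kscal e z) = kscal (c * e) z.
Proof. by rewrite /kscal ract_ract -scalerAl mul1r scalerA mulrC. Qed.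

Lemma kscal1 M (z : M) : kscal 1 z = z.
Proof. by rewrite /kscal scale1r ract1. Qed.

Lemma kscal0 M c : kscal c (0 : M) = 0.
Proof. exact: ract0l. Qed.

Lemma kscal0l M (z : M) : kscal 0 z = 0.
Proof. by rewrite /kscal scale0r ract0r. Qed.

Lemma kscalK M c (z : M) : c \is a GRing.unit -> kscal c^-1 (kscal c z) = z.
Proof. by move=> cU; rewrite kscalA mulVr ?kscal1. Qed.

Lemma kscal_sign M m (z : M) : kscal ((-1) ^+ m) z = (-1) ^+ m *: z.
Proof.
elim: m => [|m IH]; first by rewrite !expr0 kscal1 scale1r.
rewrite !exprS -kscalA IH mulN1r scaleNr /kscal.
by rewrite scaleN1r -[LHS]/(((- 1 : R) : R^c) *: _) scaleN1r.
Qed.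

Lemma kscalNl M c (z : M) : kscal (- c) z = - kscal c z.
Proof. by rewrite -mulN1r -kscalA -(expr1 (-1)) kscal_sign expr1 scaleN1r. Qed.

Lemma ract_sign M m (z : M) r : ract ((-1) ^+ m *: z) r = (-1) ^+ m *: ract z r.
Proof. by rewrite -!kscal_sign ract_kscal. Qed.

Lemma kscal_signC M m c (z : M) : kscal c ((-1) ^+ m *: z) = (-1) ^+ m *: kscal c z.
Proof. exact: ract_sign. Qed.

Lemma ract_sum M (J : finType) (F : J -> M) r : ract (\sum_j F j) r = \sum_j ract (F j) r.
Proof. exact: scaler_sumr. Qed.

Lemma ractB M (y z : M) r : ract (y - z) r = ract y r - ract z r.
Proof. exact: scalerBr. Qed.

Lemma kscal_sum M (J : finType) (F : J -> M) c :
  kscal c (\sum_j F j) = \sum_j kscal c (F j).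
Proof. exact: ract_sum. Qed.

Lemma kscalB M (y z : M) c : kscal c (y - z) = kscal c y - kscal c z.
Proof. exact: ractB. Qed.

Lemma kscal_linear M M' (f : {linear M -> M'}) c z : f (kscal c z) = kscal c (f z).
Proof. exact: linearZ. Qed.

Lemma ract_linear M M' (f : {linear M -> M'}) r z : f (ract z r) = ract (f z) r.
Proof. exact: linearZ. Qed.

End RightModules.

(** * Increasing index sequences and their faces *)

Section Tuples.
Context (n : nat).
Local Notation drop_nth := Defs.drop_nth.

Definition inc p (s : p.-tuple 'I_n) : bool := sorted ltn [seq val i | i <- s].

Lemma incP p (s : p.-tuple 'I_n) :
  reflect (forall a b : 'I_p, (a < b)%N -> (tnth s a < tnth s b)%N) (inc s).
Proof.
rewrite /inc sorted_pairwise; last exact: ltn_trans.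
rewrite pairwise_map; case: p s => [|p] s.
  by rewrite tuple0 /=; apply: ReflectT => -[].
have x0 := tnth s ord0; apply: (iffP (pairwiseP x0)) => [h a b ab|h a b].
  by rewrite !(tnth_nth x0); apply: h; rewrite ?inE ?size_tuple.
rewrite !inE !size_tuple => ap bp ab.
by have := h (Ordinal ap) (Ordinal bp) ab; rewrite !(tnth_nth x0).
Qed.

Lemma tnth_drop_nth p (s : p.+1.-tuple 'I_n) r l :
  tnth (drop_nth s r) l = tnth s (fintype.lift r l).
Proof. exact: tnth_mktuple. Qed.

Lemma inc_drop_nth p (s : p.+1.-tuple 'I_n) r : inc s -> inc (drop_nth s r).
Proof.
move/incP=> h; apply/incP => a b ab; rewrite !tnth_drop_nth; apply: h.
by rewrite /= /bump; lia.
Qed.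

Lemma xprod_drop_nth p (s : p.+1.-tuple 'I_n) r :
  (xprod (drop_nth s r) + U_(tnth s r))%MM = xprod s.
Proof.
rewrite addmC /xprod !big_tuple [RHS](bigD1_ord r) //=; congr (_ + _)%MM.
by apply: eq_bigr => l _; rewrite tnth_drop_nth.
Qed.

(** The simplicial identity. The positions live in ordinals of different sizes, hence the equations
    between their values. *)
Lemma drop_nth_swap p (s : p.+2.-tuple 'I_n) (r r' : 'I_p.+2) (l l' : 'I_p.+1) :
  r = l :> nat -> r' = l'.+1 :> nat -> (l <= l')%N ->
  drop_nth (drop_nth s r) l' = drop_nth (drop_nth s r') l.
Proof.
move=> Er Er' le_ll'; apply: eq_from_tnth => x; rewrite !tnth_drop_nth.
by congr tnth; apply: val_inj; rewrite /= /bump Er Er'; lia.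
Qed.

Definition consT p (m : 'I_n) (s : p.-tuple 'I_n) : p.+1.-tuple 'I_n := [tuple of m :: s].

Lemma inc_consT p m (s : p.-tuple 'I_n) :
  inc (consT m s) = [forall a, (m < tnth s a)%N] && inc s.
Proof.
rewrite /inc /= path_sortedE; last exact: ltn_trans.
congr (_ && _); apply/allP/forallP => [h a|h _ /mapP[i /tnthP[a ->] ->]].
  exact/h/map_f/mem_tnth.
exact: h.
Qed.

Lemma drop_nth_consT0 p m (s : p.-tuple 'I_n) : drop_nth (consT m s) ord0 = s.
Proof.
by apply: eq_from_tnth => a; rewrite tnth_drop_nth (tnth_nth m) /= [RHS](tnth_nth m).
Qed.

Lemma drop_nth_consTS p m (s : p.+1.-tuple 'I_n) r :
  drop_nth (consT m s) (fintype.lift ord0 r) = consT m (drop_nth s r).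
Proof.
apply: eq_from_tnth => a; rewrite tnth_drop_nth.
case: (unliftP ord0 a) => [b|] ->.
  rewrite [RHS](tnth_nth m) /= -(tnth_nth m (drop_nth s r)) tnth_drop_nth.
  rewrite !(tnth_nth m) /=.
  by have -> : bump (bump 0 r) (bump 0 b) = (bump r b).+1 by rewrite /bump; lia.
by rewrite !(tnth_nth m).
Qed.

Lemma tnth_consTS p m (s : p.-tuple 'I_n) r : tnth (consT m s) (fintype.lift ord0 r) = tnth s r.
Proof. by rewrite !(tnth_nth m). Qed.

Lemma xprod_consT p m (s : p.-tuple 'I_n) : xprod (consT m s) = (U_(m) + xprod s)%MM.
Proof. by rewrite /xprod big_cons. Qed.

Lemma admissibleP (G : {pred 'X_{1..n}}) p (s : p.-tuple 'I_n) u :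
  reflect [/\ u \in G, inc s & forall r, ((tnth s r).+1 < mmax u)%N] (admissible G (s, u)).
Proof.
apply: (iffP and3P) => [[uG us /all_tnthP hs]|[uG us hs]]; split=> //.
exact/all_tnthP.
Qed.
End Tuples.

(** * The differential in the twisted basis *)

Lemma subr_subrAC (V : zmodType) (a b c e : V) : a - b - (c - e) = a - c - (b - e).
Proof. by rewrite !opprB addrACA [RHS]addrACA [- b - c]addrC. Qed.

Section TwistedBasis.
Context (k : comUnitRingType) (n : nat) (q : 'M[k]_n) (G : {pred 'X_{1..n}}).
Context (qP : skew_param q) (GP : stable_antichain G).
Local Notation R := (skewpoly q).
Local Notation L := (L q G).
Local Notation d := (@d k n q G).
Local Notation C := (skewC q).
Local Notation drop_nth := Defs.drop_nth.
Local Notation g i u := (gfun G (U_(i) + u)%MM).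
Local Notation y i u := (U_(i) + u - g i u)%MM.

(* The cocycle factor makes the multigraded differential look as over the
   commutative polynomial ring. *)
Definition twisted_basis p (s : p.-tuple 'I_n) u c : L p :=
  kscal (C (xprod s + u)%MM c)^-1 (ract (ebasis q G s u) (mono q c)).

Local Notation twb := twisted_basis.

Lemma ebasis_adm p (s : symbol G p) : ebasis q G (val s).1 (val s).2 = << s >>.
Proof. by rewrite /ebasis -surjective_pairing valK. Qed.

Lemma ebasis_nadm p (s : p.-tuple 'I_n) u : ~~ admissible G (s, u) -> ebasis q G s u = 0.
Proof. by move=> h; rewrite /ebasis insubN. Qed.

Lemma twb_nadm p (s : p.-tuple 'I_n) u c : ~~ admissible G (s, u) -> twb s u c = 0.
Proof. by move=> h; rewrite /twb ebasis_nadm // ract0l kscal0. Qed.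

Lemma skewC0r a : C a 0%MM = 1.
Proof. by apply: skewC_eq1 => i j _; rewrite mnm0E muln0. Qed.

Lemma ebasis_twb p (s : p.-tuple 'I_n) u : ebasis q G s u = twb s u 0%MM.
Proof. by rewrite /twb skewC0r invr1 kscal1 mono0 ract1. Qed.

(** By bimultiplicativity of C, the remaining unit depends only on b and on the total multidegree of
    the basis element, which all terms of a differential share. *)
Lemma ract_twb p (s : p.-tuple 'I_n) u c b :
  ract (twb s u c) (mono q b) = kscal (C (xprod s + u + c)%MM b) (twb s u (c + b)%MM).
Proof.
rewrite /twb ract_kscal ract_ract mono_mul ractZ !kscalA; congr kscal.
move: (xprod s + u)%MM => a; rewrite skewCDr skewCDl invrM ?skewC_unit //.
by rewrite mulrACA mulrV ?skewC_unit // mul1r mulrC.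
Qed.

Lemma twb_ract p (s : p.-tuple 'I_n) u c :
  twb s u c = kscal (C (xprod s + u)%MM c)^-1 (ract (twb s u 0%MM) (mono q c)).
Proof. by rewrite -ebasis_twb. Qed.

(** A factor of C needs a variable of the left monomial after one of the right, and max(u_r) is at
    most min(y_r). So C(x_sigma_r, y_r) in [d] may be read as C(x_sigma_r * u_r, y_r), the unit in
    the twisted basis. *)
Lemma skewC_gfun i u : up G (U_(i) + u)%MM -> C (g i u) (y i u) = 1.
Proof.
move=> xU; apply: skewC_eq1 => l m ml; case: (posnP (g i u l)) => [->//|gl].
apply/eqP; rewrite muln_eq0 -leqn0 leqNgt gl /= mnmBE subn_eq0 leqNgt.
apply/negP => /(gfun_max_le_min GP xU); have := ltn_mmax gl; lia.
Qed.

Lemma d_adm p (s : p.+1.-tuple 'I_n) u : admissible G (s, u) ->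
  d (ebasis q G s u) =
  \sum_(r < p.+1) (-1) ^+ r.+1 *:
     (twb (drop_nth s r) u (U_(tnth s r))%MM
      - twb (drop_nth s r) (g (tnth s r) u) (y (tnth s r) u)).
Proof.
move=> adm; have [uG us hs] := admissibleP _ _ _ adm.
rewrite /ebasis insubT /d liftU scale1r /d_basis /=.
under [RHS]eq_bigr do rewrite scalerBr; rewrite sumrB.
congr (_ - _).
  by apply: eq_bigr => r _; rewrite !ractZ kscal_sign.
rewrite big_mkcond; apply: eq_bigr => r _; case: ifPn => [_|/twb_nadm ->].
  rewrite !ractZ kscal_sign /twb; do 3 congr (_ _ _).
  by rewrite skewCDl skewC_gfun ?mulr1 // up_var // up_gen.
by rewrite scaler0.
Qed.

Lemma d0 p : d (0 : L p.+1) = 0.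
Proof. exact: linear0. Qed.

Lemma dD p (x z : L p.+1) : d (x + z) = d x + d z.
Proof. exact: linearD. Qed.

Lemma d_ract p (z : L p.+1) r : d (ract z r) = ract (d z) r.
Proof. exact: ract_linear. Qed.

Lemma d_kscal p (z : L p.+1) c : d (kscal c z) = kscal c (d z).
Proof. exact: kscal_linear. Qed.

Lemma d_twb_adm p (s : p.+1.-tuple 'I_n) u c : admissible G (s, u) ->
  d (twb s u c) =
  \sum_(r < p.+1) (-1) ^+ r.+1 *:
     (twb (drop_nth s r) u (c + U_(tnth s r))%MM
      - twb (drop_nth s r) (g (tnth s r) u) (c + y (tnth s r) u)%MM).
Proof.
move=> adm; have [uG _ _] := admissibleP _ _ _ adm.
rewrite twb_ract d_kscal d_ract -ebasis_twb d_adm // ract_sum kscal_sum.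
apply: eq_bigr => r _; rewrite ract_sign kscal_signC ractB kscalB.
(* Both kinds of terms have multidegree x_sigma * u, so multiplying by x^c produces exactly the unit
   whose inverse stands in front. *)
have cancel_C v b : (xprod (drop_nth s r) + v + b = xprod s + u)%MM ->
    kscal (C (xprod s + u)%MM c)^-1 (ract (twb (drop_nth s r) v b) (mono q c))
    = twb (drop_nth s r) v (c + b)%MM.
  by move=> E; rewrite ract_twb E [(b + c)%MM]addmC kscalK //; apply: skewC_unit.
rewrite !cancel_C //.
  rewrite -addmA [(gfun _ _ + _)%MM]addmC submK; last first.
    by rewrite (gfun_le GP) // up_var // up_gen.
  by rewrite addmA xprod_drop_nth.
by rewrite -addmA [(u + _)%MM]addmC addmA xprod_drop_nth.
Qed.

(* When sigma reaches past max(u), the terms of the largest index cancel and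
   all the others vanish. *)
Lemma d_twb p (s : p.+1.-tuple 'I_n) u c : inc s -> u \in G ->
  d (twb s u c) =
  \sum_(r < p.+1) (-1) ^+ r.+1 *:
     (twb (drop_nth s r) u (c + U_(tnth s r))%MM
      - twb (drop_nth s r) (g (tnth s r) u) (c + y (tnth s r) u)%MM).
Proof.
move=> us uG; have [|nadm] := boolP (admissible G (s, u)); first exact: d_twb_adm.
rewrite twb_nadm // linear0; symmetry.
have max_le : (mmax u <= (tnth s ord_max).+1)%N.
  rewrite leqNgt; apply: contraNN nadm => lt_max; apply/admissibleP; split=> // r.
  apply: leq_ltn_trans lt_max; rewrite ltnS.
  have := leq_ord r; rewrite leq_eqVlt => /orP[/eqP r_max|r_max].
    by have -> : r = ord_max by apply: val_inj.
  by apply/ltnW/(incP _ us).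
apply: big1 => r _; have [->|r_max] := eqVneq r ord_max.
  by rewrite gfun_var_gen // addmK subrr scaler0.
have [l El] : exists l, ord_max = fintype.lift r l.
  by case: (unliftP r ord_max) r_max => [l ->|->]; [exists l | rewrite eqxx].
(* For the other r, sigma_r keeps the last index of sigma, which is not below max(u), and max(u_r)
   is at most max(u). *)
have nadm' v : (mmax v <= mmax u)%N -> ~~ admissible G (drop_nth s r, v).
  move=> vu; apply/admissibleP => -[_ _ /(_ l)].
  by rewrite tnth_drop_nth -El; lia.
rewrite !twb_nadm ?subrr ?scaler0 ?nadm' //.
by have := mmax_gfun_var GP (tnth s r) (up_gen uG); rewrite (gfun_gen GP uG).
Qed.

(** Both sides are g(x_i * x_j * u). *)
Lemma gfun_varC i j u : u \in G -> g i (g j u) = g j (g i u).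
Proof.
move=> uG; have uU := up_gen uG.
by rewrite !gfun_var_gfun ?up_var // !addmA [(U_(i) + _)%MM]addmC.
Qed.

Lemma dd_twb p (s : p.+2.-tuple 'I_n) u c : inc s -> u \in G -> d (d (twb s u c)) = 0.
Proof.
move=> us uG; rewrite d_twb // linear_sum /=.
have gG i v : v \in G -> g i v \in G by move=> vG; rewrite gfun_in ?up_var ?up_gen.
pose i_ r := tnth s (inord r).
pose j_ r l := tnth (drop_nth s (inord r)) (inord l).
pose s_ r l := drop_nth (drop_nth s (inord r)) (inord l).
pose f r l := twb (s_ r l) u (c + U_(i_ r) + U_(j_ r l))%MM
  - twb (s_ r l) (g (j_ r l) u) (c + U_(i_ r) + y (j_ r l) u)%MM
  - (twb (s_ r l) (g (i_ r) u) (c + y (i_ r) u + U_(j_ r l))%MM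
     - twb (s_ r l) (g (j_ r l) (g (i_ r) u))
         (c + y (i_ r) u + y (j_ r l) (g (i_ r) u))%MM).
transitivity (\sum_(r < p.+2) \sum_(l < p.+1) (-1) ^+ r *: ((-1) ^+ l *: f r l)).
  (* The inner differentials may fall on non-admissible symbols; [d_twb] covers these too, since
     sigma_r is increasing and u_r lies in G. *)
  apply: eq_bigr => r _; rewrite linearZ /= linearB /= !d_twb ?inc_drop_nth ?gG //.
  rewrite -sumrB scaler_sumr; apply: eq_bigr => l _.
  rewrite -scalerBr !exprS !mulN1r !scaleNr scalerN opprK.
  by rewrite /f /s_ /i_ /j_ !inord_val.
apply: alternating_double_sum => r l rl lp; rewrite /f.
(* Exchanging (r, l) with (l+1, r) deletes the same two indices in the opposite order, so f must be
   shown symmetric in i and j. *)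
have -> : s_ l.+1 r = s_ r l.
  by symmetry; apply: drop_nth_swap; rewrite ?inordK //; lia.
have -> : j_ l.+1 r = i_ r.
  rewrite /j_ tnth_drop_nth; congr tnth; apply: val_inj.
  by rewrite /= /bump !inordK //; lia.
have -> : j_ r l = i_ l.+1.
  rewrite /j_ tnth_drop_nth; congr tnth; apply: val_inj.
  by rewrite /= /bump !inordK //; lia.
move: (s_ r l) (i_ r) (i_ l.+1) => {us rl lp i_ j_ s_ f} S i j.
(* The intermediate generator cancels: both sides are c * x_i * x_j * u divided by g(x_i * x_j *
   u). *)
have -> : (c + y i u + y j (g i u) = c + y j u + y i (g j u))%MM.
  have uU := up_gen uG; have gU m := up_gen (gG m _ uG).
  have /mnm_lepP le1 := gfun_le GP (up_var i uU).
  have /mnm_lepP le2 := gfun_le GP (up_var j uU).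
  have /mnm_lepP le3 := gfun_le GP (up_var j (gU i)).
  have /mnm_lepP le4 := gfun_le GP (up_var i (gU j)).
  rewrite (gfun_varC j i uG) in le3 *; apply/mnmP => m.
  have := le1 m; have := le2 m; have := le3 m; have := le4 m.
  by rewrite !(mnmDE, mnmBE); lia.
rewrite (gfun_varC j i uG).
have -> : (c + U_(i) + y j u = c + y j u + U_(i))%MM by rewrite -!addmA [(U_(i) + _)%MM]addmC.
have -> : (c + U_(j) + y i u = c + y i u + U_(j))%MM by rewrite -!addmA [(U_(j) + _)%MM]addmC.
rewrite -[(c + U_(j) + U_(i))%MM]addmA [(U_(j) + U_(i))%MM]addmC addmA.
exact: subr_subrAC.
Qed.
End TwistedBasis.

(** * Exactness *)

(** Downward induction: only finitely many monomials have degree below b, and their number above u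
    drops when u is replaced by a larger one of them. *)
Lemma lexlt_ind n b (Q : 'X_{1..n} -> Prop) :
  (forall u, (forall v, lexlt u v -> (mdeg v < b)%N -> Q v) -> Q u) -> forall u, Q u.
Proof.
move=> step u; pose above u := [set v : 'X_{1..n < b} | lexlt u (bmnm v)].
have [m] := ubnP #|above u|; elim: m u => // m IH u; rewrite ltnS => um.
apply: step => v uv vb; apply: IH; apply: leq_trans um.
apply/proper_card/properP; split.
  by apply/subsetP => w; rewrite !inE; apply: lexlt_trans.
by exists (BMultinom vb); rewrite !inE //= lexlt_irr.
Qed.

Definition minvar n (c : 'X_{1..n}) : option 'I_n :=
  [pick m : 'I_n | (0 < c m)%N && [forall j : 'I_n, (0 < c j)%N ==> (m <= j)%N]].

Lemma minvar_eq n (c : 'X_{1..n}) m :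
  (0 < c m)%N -> (forall j : 'I_n, (0 < c j)%N -> (m <= j)%N) -> minvar c = Some m.
Proof.
move=> cm hm; rewrite /minvar; case: pickP => [m' /andP[cm' /forallP hm']|/(_ m)].
  congr Some; apply: val_inj; apply: anti_leq; rewrite hm // andbT.
  by have := hm' m; rewrite cm.
by rewrite cm /= => /negbT/forallPn[j]; rewrite negb_imply => /andP[/hm ->].
Qed.

Variant minvar_spec n (c : 'X_{1..n}) : option 'I_n -> Prop :=
| MinvarSome m of (0 < c m)%N & (forall j : 'I_n, (0 < c j)%N -> (m <= j)%N) :
    minvar_spec c (Some m)
| MinvarNone of (forall j, c j = 0%N) : minvar_spec c None.

Lemma minvarP n (c : 'X_{1..n}) : minvar_spec c (minvar c).
Proof.
case E : (minvar c) => [m|].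
  move: E; rewrite /minvar; case: pickP => // m' /andP[cm /forallP h] [<-].
  by apply: MinvarSome => // j cj; have := h j; rewrite cj.
apply: MinvarNone => j; apply/eqP; rewrite -leqn0 leqNgt; apply/negP => cj.
case: (@arg_minnP _ j (fun i => 0 < c i)%N (@nat_of_ord n) cj) => m cm hm.
by rewrite (minvar_eq cm hm) in E.
Qed.

Lemma subrD3 (V : zmodType) (x z a b c e : V) :
  x + z - (a + b) - (c + e) = (x - a - c) + (z - b - e).
Proof. by rewrite !opprD (addrACA x z) (addrACA (x - a)). Qed.

Lemma subr_cancel4 (V : zmodType) (e x a b : V) :
  e - - (- (e - x) + (a - b)) - a = x - b.
Proof.
by rewrite opprK opprB addrA [e + _]addrC subrK -addrA [a - b]addrC addrK.
Qed.

Lemma subr_sumB (V : zmodType) m (F F' : 'I_m -> V) x :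
  x - \sum_r F r + \sum_r F' r = x - \sum_r (F r - F' r).
Proof. by rewrite sumrB opprB addrA addrAC. Qed.

Section Homotopy.
Context (k : comUnitRingType) (n : nat) (q : 'M[k]_n) (G : {pred 'X_{1..n}}).
Context (qP : skew_param q) (GP : stable_antichain G).
Local Notation R := (skewpoly q).
Local Notation L := (L q G).
Local Notation d := (@d k n q G).
Local Notation C := (skewC q).
Local Notation drop_nth := Defs.drop_nth.
Local Notation g i u := (gfun G (U_(i) + u)%MM).
Local Notation y i u := (U_(i) + u - g i u)%MM.
Local Notation twb := (twisted_basis q G).
Implicit Types c u : 'X_{1..n}.

Lemma freegU_ract p (s : symbol G p) (r : R) : << (r : R^c) *g s >> = ract (<< s >> : L p) r.
Proof. by apply/eqP/freeg_eqP => t; rewrite coeffZ !coeffU mul1r. Qed.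

Lemma twb_freegU p (s : symbol G p) e c :
  kscal e (twb (val s).1 (val s).2 c) =
  << (e * (C (xprod (val s).1 + (val s).2)%MM c)^-1) *: mono q c : R^c *g s >> :> L p.
Proof. by rewrite freegU_ract ractZ /twisted_basis ebasis_adm kscalA. Qed.

(** The admissible twisted elements span [L p] over k, so k-linear statements need checking only on
    them. *)
Lemma L_ind p (P : L p -> Prop) :
  P 0 -> (forall x z, P x -> P z -> P (x + z)) ->
  (forall e (s : symbol G p) c, P (kscal e (twb (val s).1 (val s).2 c))) ->
  forall z, P z.
Proof.
move=> P0 PD PE; elim/freeg_ind_dom0 => // r s z _ _ Pz; apply: (PD) => // {z Pz}.
rewrite freegU_ract; elim/skewpoly_ind: r => [|e c r IH]; first by rewrite ract0r.
rewrite ractDr; apply: PD; last exact: IH.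
rewrite ractZ -ebasis_adm (ebasis_twb q).
by rewrite (ract_twb G qP) add0m kscalA.
Qed.

Lemma dN p (z : L p.+1) : d (- z) = - d z.
Proof. exact: linearN. Qed.

Lemma dd p (z : L p.+2) : d (d z) = 0.
Proof.
elim/L_ind: z => [|x z dx dz|e s c].
- by rewrite !d0.
- by rewrite !dD dx dz addr0.
have [sG sI _] := admissibleP _ _ _ (valP s : admissible G ((val s).1, (val s).2)).
by rewrite 2!d_kscal (dd_twb qP GP) // kscal0.
Qed.

(** * k-linear maps prescribed on the twisted basis *)

Section KLinearExtension.
Context (p : nat) (M : lmodType R^c) (F : p.-tuple 'I_n -> 'X_{1..n} -> 'X_{1..n} -> M).

(** The factor C undoes the inverse unit in [twb], so that E(sigma, u, a) itself is sent to F. Two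
    additive extensions are nested in [twb_ext]: over the symbols, and over the monomials in each
    coefficient from R. *)
Let inner (s : symbol G p) (a : 'X_{1..n}) (e : k) : M :=
  kscal (e * C (xprod (val s).1 + (val s).2)%MM a) (F (val s).1 (val s).2 a).

Let innerD s a : {morph inner s a : x z / x + z}.
Proof. by move=> x z; rewrite /inner mulrDl kscalDl. Qed.

Definition twb_ext : L p -> M :=
  additive_ext (fun s (r : R^c) => additive_ext (inner s) (r : {freeg 'X_{1..n} / k})).

Let twb_ext_gD s :
  {morph (fun r : R^c => additive_ext (inner s) (r : {freeg 'X_{1..n} / k})) : x z / x + z}.
Proof. exact: additive_extD. Qed.

Lemma twb_extD : {morph twb_ext : x z / x + z}.
Proof. exact: additive_extD. Qed.

Lemma twb_ext_twb e (s : symbol G p) c :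
  twb_ext (kscal e (twb (val s).1 (val s).2 c)) = kscal e (F (val s).1 (val s).2 c).
Proof.
rewrite twb_freegU /twb_ext additive_extU //.
have -> : forall a, a *: mono q c = << a *g c >> :> {freeg 'X_{1..n} / k}.
  by move=> a; apply/eqP/freeg_eqP => t; rewrite coeffZ !coeffU mul1r.
by rewrite additive_extU // /inner mulrVK ?skewC_unit.
Qed.

Lemma twb_ext0 : twb_ext 0 = 0.
Proof. by apply: (addrI (twb_ext 0)); rewrite -twb_extD !addr0. Qed.

Lemma twb_ext_kscal e z : twb_ext (kscal e z) = kscal e (twb_ext z).
Proof.
elim/L_ind: z => [|x z Ex Ez|e' s c].
- by rewrite kscal0 twb_ext0 kscal0.
- by rewrite kscalDr !twb_extD kscalDr Ex Ez.
by rewrite kscalA !twb_ext_twb kscalA.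
Qed.

Lemma twb_extE s u c :
  (~~ admissible G (s, u) -> F s u c = 0) -> twb_ext (twb s u c) = F s u c.
Proof.
have [adm _|nadm ->//] := boolP (admissible G (s, u)).
  by have := twb_ext_twb 1 (Sub (s, u) adm : symbol G p) c; rewrite !kscal1.
by rewrite twb_nadm // twb_ext0.
Qed.

End KLinearExtension.

(** * The contracting homotopy of the Koszul part *)

(** The sign compensates the -1 of the first term of [d]. If m is not before all of sigma, or not
    before the last variable of u, the new symbol is not admissible and the value is 0 by itself. *)
Definition cone p (s : p.-tuple 'I_n) u c : L p.+1 :=
  if minvar c is Some m then - twb (consT m s) u (c - U_(m))%MM else 0.

Definition hom p : L p -> L p.+1 := twb_ext (@cone p).

Lemma consT_nadm p m (s : p.-tuple 'I_n) u :
  ~~ admissible G (s, u) -> ~~ admissible G (consT m s, u).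
Proof.
apply: contraNN => /admissibleP[uG]; rewrite inc_consT => /andP[_ us] hs.
by apply/admissibleP; split=> // r; have := hs (fintype.lift ord0 r); rewrite tnth_consTS.
Qed.

Lemma hom_twb p (s : p.-tuple 'I_n) u c : hom (twb s u c) = cone s u c.
Proof.
apply: twb_extE => nadm; rewrite /cone; case: minvar => // m.
by rewrite twb_nadm ?oppr0 ?consT_nadm.
Qed.

Lemma homD p : {morph @hom p : x z / x + z}. Proof. exact: twb_extD. Qed.

Lemma hom_kscal p e (z : L p) : hom (kscal e z) = kscal e (hom z).
Proof. exact: twb_ext_kscal. Qed.

Lemma homN p (z : L p) : hom (- z) = - hom z.
Proof. by apply: (addrI (hom z)); rewrite -homD !subrr /hom twb_ext0. Qed.

Lemma hom_sum p m (F : 'I_m -> L p) : hom (\sum_j F j) = \sum_j hom (F j).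
Proof. exact: (big_morph _ (@homD p) (twb_ext0 _)). Qed.

Lemma hom_sign p m (z : L p) : hom ((-1) ^+ m *: z) = (-1) ^+ m *: hom z.
Proof. by rewrite -!kscal_sign hom_kscal. Qed.

(** This is 1 - dh - hd. A cycle differs from its defect by a boundary, so local nilpotency of this
    map yields exactness. *)
Definition defect p (z : L p.+1) : L p.+1 := z - d (hom z) - hom (d z).

Lemma defectD p : {morph @defect p : x z / x + z}.
Proof.
by move=> x z; rewrite /defect homD !dD homD; apply: subrD3.
Qed.

Lemma defect_kscal p e (z : L p.+1) : defect (kscal e z) = kscal e (defect z).
Proof. by rewrite /defect hom_kscal !d_kscal hom_kscal !kscalB. Qed.

Lemma defect0 p : defect (0 : L p.+1) = 0.
Proof. by apply: (addrI (defect 0)); rewrite -defectD !addr0. Qed.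

Definition nilpotent_at p (z : L p.+1) : Prop := exists m, iter m (@defect p) z = 0.

Lemma iter_defectD p m (x z : L p.+1) :
  iter m (@defect p) (x + z) = iter m (@defect p) x + iter m (@defect p) z.
Proof. by elim: m => //= m ->; rewrite defectD. Qed.

Lemma iter_defect0 p m : iter m (@defect p) 0 = 0.
Proof. by elim: m => //= m ->; rewrite defect0. Qed.

Lemma nilpotent_at0 p : nilpotent_at (0 : L p.+1).
Proof. by exists 0%N. Qed.

Lemma nilpotent_atD p (x z : L p.+1) :
  nilpotent_at x -> nilpotent_at z -> nilpotent_at (x + z).
Proof.
move=> [m1 E1] [m2 E2]; exists (m1 + m2)%N; rewrite iter_defectD.
by rewrite [in iter _ _ x]addnC !iterD E1 E2 !iter_defect0 addr0.
Qed.

Lemma nilpotent_at_kscal p e (z : L p.+1) : nilpotent_at z -> nilpotent_at (kscal e z).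
Proof.
move=> [m E]; exists m; suff -> : iter m (@defect p) (kscal e z) = kscal e (iter m (@defect p) z).
  by rewrite E kscal0.
by elim: m {E} => //= m ->; rewrite defect_kscal.
Qed.

Lemma nilpotent_at_sign p m (z : L p.+1) :
  nilpotent_at z -> nilpotent_at ((-1) ^+ m *: z).
Proof. by move=> nz; rewrite -kscal_sign; apply: nilpotent_at_kscal. Qed.

Lemma nilpotent_atN p (z : L p.+1) : nilpotent_at z -> nilpotent_at (- z).
Proof. by move=> /(@nilpotent_at_sign _ 1); rewrite expr1 scaleN1r. Qed.

Lemma nilpotent_at_sum p m (F : 'I_m -> L p.+1) :
  (forall j, nilpotent_at (F j)) -> nilpotent_at (\sum_j F j).
Proof.
move=> nF; elim/big_ind: _ => // [|x z]; first exact: nilpotent_at0.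
exact: nilpotent_atD.
Qed.

Lemma nilpotent_at_defect p (z : L p.+1) : nilpotent_at (defect z) -> nilpotent_at z.
Proof. by move=> [m E]; exists m.+1; rewrite iterSr. Qed.

(** * Degrees and the defect of basis elements *)

Lemma mdeg_quotient i u : up G u -> (mdeg (g i u) + mdeg (y i u) = (mdeg u).+1)%N.
Proof.
move=> uU; have := submK (gfun_le GP (up_var i uU)) => /(congr1 mdeg).
by rewrite [mdeg (_ + u)%MM]mdegD mdeg1 mdegD; lia.
Qed.

Lemma mdeg_drop_nth p (s : p.+1.-tuple 'I_n) r :
  (mdeg (xprod s) = (mdeg (xprod (drop_nth s r))).+1)%N.
Proof. by rewrite -(xprod_drop_nth s r) mdegD mdeg1 addn1. Qed.

Lemma mdeg_sub_var (c : 'X_{1..n}) (m : 'I_n) :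
  (0 < c m)%N -> (mdeg c = (mdeg (c - U_(m))%MM).+1)%N.
Proof.
move=> cm; rewrite -[in LHS](submK (m := U_(m)%MM) (m' := c)) ?lep1mP -?lt0n //.
by rewrite mdegD mdeg1 addn1.
Qed.

Lemma defect_twb p (s : p.+1.-tuple 'I_n) u c : u \in G -> inc s ->
  defect (twb s u c) =
  twb s u c - d (cone s u c)
  - \sum_(r < p.+1) (-1) ^+ r.+1 *: cone (drop_nth s r) u (c + U_(tnth s r))%MM
  + \sum_(r < p.+1) (-1) ^+ r.+1 *:
      cone (drop_nth s r) (g (tnth s r) u) (c + y (tnth s r) u)%MM.
Proof.
move=> uG us; rewrite /defect hom_twb (d_twb qP GP) // hom_sum.
rewrite subr_sumB; congr (_ - _); apply: eq_bigr => r _.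
by rewrite -scalerBr hom_sign homD homN !hom_twb.
Qed.


(** Multiplying c by a later variable leaves its first variable m in place, so the homotopy still
    moves x_m. *)
Lemma cone_add_var p (s : p.-tuple 'I_n) u c (i : 'I_n) m :
  (0 < c m)%N -> (forall j : 'I_n, (0 < c j)%N -> (m <= j)%N) -> (m < i)%N ->
  cone s u (c + U_(i))%MM = - twb (consT m s) u (c - U_(m) + U_(i))%MM.
Proof.
move=> cm hm mi; rewrite /cone (@minvar_eq _ _ m); first 1 last.
- by rewrite mnmDE ltn_addr.
- move=> j; rewrite mnmDE mnm1E; case: eqP => [<- _|_]; first exact: ltnW.
  by rewrite addn0; apply: hm.
congr (- twb _ _ _); apply/mnmP => j; rewrite !(mnmDE, mnmBE, mnm1E).
by have [<-|_] := eqVneq m j; lia.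
Qed.

(** The variable put in front of sigma is not below the r-th entry, so the new sequence is not
    increasing. *)
Lemma cone_not_inc p (s : p.-tuple 'I_n) u c r :
  (forall m, (0 < c m)%N -> (tnth s r <= m)%N) -> cone s u c = 0.
Proof.
move=> hc; rewrite /cone; case: minvarP => // m /hc le_m _.
rewrite twb_nadm ?oppr0 //; apply/admissibleP => -[_].
by rewrite inc_consT => /andP[/forallP/(_ r)]; lia.
Qed.

(** The differential moves the first index of sigma into the monomial, where it comes first, and the
    homotopy moves it back. *)
Lemma cone_head p (s : p.+1.-tuple 'I_n) u c :
  (forall m, (0 < c m)%N -> (tnth s ord0 <= m)%N) ->
  cone (drop_nth s ord0) u (c + U_(tnth s ord0))%MM = - twb s u c.
Proof.
move=> hc; rewrite /cone (@minvar_eq _ _ (tnth s ord0)); first 1 last.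
- by rewrite mnmDE mnm1E eqxx addn1.
- by move=> j; rewrite mnmDE mnm1E; case: eqP => [<-//|_]; rewrite addn0; apply: hc.
rewrite addmK; congr (- twb _ _ _); apply: eq_from_tnth => r.
case: (unliftP ord0 r) => [l|] -> //.
by rewrite tnth_consTS tnth_drop_nth.
Qed.

(** In the defect of E(sigma, u, c) all terms that keep u cancel. The others have generators g(x_i *
    u) with x_i before the last variable of u; these are lexicographically larger than u, and the
    total degree is unchanged. *)
Lemma nilpotent_at_twb b p u (s : p.+1.-tuple 'I_n) c :
  (mdeg (xprod s + u + c)%MM < b)%N -> nilpotent_at (twb s u c).
Proof.
elim/(@lexlt_ind n b): u s c => u IH s c deg_lt.
have [adm|nadm] := boolP (admissible G (s, u)); last first.
  by rewrite twb_nadm //; apply: nilpotent_at0.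
have [uG us hs] := admissibleP _ _ _ adm; have uU := up_gen uG.
have IHg (i : 'I_n) (s' : p.+1.-tuple 'I_n) c' :
    (i.+1 < mmax u)%N -> (mdeg (xprod s' + g i u + c')%MM < b)%N ->
    nilpotent_at (twb s' (g i u) c').
  move=> iu deg'; apply: IH => //; first exact: lexlt_gfun_var.
  by move: deg'; rewrite !mdegD; lia.
rewrite !mdegD in deg_lt.
apply: nilpotent_at_defect; rewrite defect_twb //; apply: nilpotent_atD; last first.
  apply: nilpotent_at_sum => r; apply: nilpotent_at_sign; rewrite /cone.
  case: minvarP => [m cm _|_]; last exact: nilpotent_at0.
  apply/nilpotent_atN/IHg => //; rewrite xprod_consT !mdegD mdeg1.
  have := mdeg_sub_var cm; rewrite mdegD.
  by have := mdeg_quotient (tnth s r) uU; have := mdeg_drop_nth s r; lia.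
(* Either the first variable of c precedes sigma and can be put in front of it, or all variables of
   c, if any, are at or after the first entry of sigma. *)
have [[m [Em [cm hm admm]]]|hd] : (exists m : 'I_n, minvar c = Some m /\ [/\ (0 < c m)%N,
    forall j : 'I_n, (0 < c j)%N -> (m <= j)%N & admissible G (consT m s, u)])
    \/ (forall m : 'I_n, (0 < c m)%N -> (tnth s ord0 <= m)%N).
- case: minvarP => [m cm hm|c0]; last by right=> m; rewrite c0.
  have [lt_m|le_m] := ltnP m (tnth s ord0); last by right=> j /hm; apply: leq_trans.
  left; exists m; split=> //; split=> //.
  apply/admissibleP; split=> // [|r].
    rewrite inc_consT us andbT; apply/forallP => r; case: (unliftP ord0 r) => [l|] -> //.
    by apply: ltn_trans lt_m _; apply: (incP _ us).
  case: (unliftP ord0 r) => [l|] ->; first by rewrite tnth_consTS.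
  by have := hs ord0; have -> : tnth (consT m s) ord0 = m by []; lia.
(* In the differential of the homotopy, A collects the Koszul terms of the old indices, B their
   terms with changed generator, and X the changed term of the new index m. *)
- pose A r := twb (consT m (drop_nth s r)) u (c - U_(m) + U_(tnth s r))%MM.
  pose B r := twb (consT m (drop_nth s r)) (g (tnth s r) u)
                (c - U_(m) + y (tnth s r) u)%MM.
  pose X := twb s (g m u) (c - U_(m) + y m u)%MM.
  have [_ usm /(_ ord0) mu] := admissibleP _ _ _ admm.
  rewrite (tnth_nth m) /= in mu.
  have -> : cone s u c = - twb (consT m s) u (c - U_(m))%MM by rewrite /cone Em.
  have dm : d (twb (consT m s) u (c - U_(m))%MM) =
      - (twb s u c - X) + (\sum_(r < p.+1) (-1) ^+ r *: A r - \sum_(r < p.+1) (-1) ^+ r *: B r).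
    rewrite d_twb // big_ord_recl expr1 scaleN1r drop_nth_consT0.
    rewrite (tnth_nth m) /= submK ?lep1mP -?lt0n //; congr (_ + _).
    rewrite -sumrB; apply: eq_bigr => r _.
    rewrite drop_nth_consTS tnth_consTS -scalerBr; congr (_ *: _).
    by rewrite !exprS !mulN1r opprK.
  rewrite dN dm; have -> : \sum_(r < p.+1) (-1) ^+ r.+1 *:
      cone (drop_nth s r) u (c + U_(tnth s r))%MM = \sum_(r < p.+1) (-1) ^+ r *: A r.
    apply: eq_bigr => r _; have := usm; rewrite inc_consT => /andP[/forallP/(_ r) mr _].
    by rewrite (cone_add_var _ _ cm hm mr) exprS mulN1r scaleNr scalerN opprK.
  (* E cancels against its copy in dh, and the A terms of dh against those of hd; X and the B terms
     remain. *)
  rewrite subr_cancel4; apply: nilpotent_atD.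
    apply: IHg => //; have := mdeg_quotient m uU; have := mdeg_sub_var cm.
    by rewrite !mdegD; lia.
  apply/nilpotent_atN/nilpotent_at_sum => r; apply/nilpotent_at_sign/IHg => //.
  have := mdeg_quotient (tnth s r) uU; have := mdeg_sub_var cm.
  by have := mdeg_drop_nth s r; rewrite xprod_consT !mdegD mdeg1; lia.
(* Here the homotopy kills E, and in hd only the term of the first index survives among those
   keeping u; it gives E back. *)
- have -> : cone s u c = 0 by apply: cone_not_inc hd.
  rewrite d0 subr0 big_ord_recl cone_head // expr1 scaleN1r opprK.
  rewrite big1 ?addr0 ?subrr; first exact: nilpotent_at0.
  move=> i _; have p0 : (0 < p)%N by apply: leq_ltn_trans (ltn_ord i).
  have hd_drop : tnth (drop_nth s (fintype.lift ord0 i)) (Ordinal p0) = tnth s ord0.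
    by rewrite tnth_drop_nth; congr tnth; apply: val_inj.
  rewrite (@cone_not_inc _ _ _ _ (Ordinal p0)) ?scaler0 // hd_drop => m.
  rewrite mnmDE mnm1E; case: eqP => [<- _|_]; last by rewrite addn0; apply: hd.
  by apply/ltnW/(incP _ us).
Qed.

Lemma nilpotent_at_all p (z : L p.+1) : nilpotent_at z.
Proof.
elim/L_ind: z => [|x z nx nz|e s c]; first exact: nilpotent_at0.
  exact: nilpotent_atD.
exact/nilpotent_at_kscal/nilpotent_at_twb.
Qed.

(** For a cycle z, the defect is z - dhz, again a cycle and killed by one iteration less. If it
    equals dx, then z = d(x + hz). *)
Lemma exact_L p (z : L p.+1) : d z = 0 -> exists x, d x = z.
Proof.
have [m] := nilpotent_at_all z; elim: m z => [z /= -> _|m IH z].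
  by exists 0; apply: d0.
rewrite iterSr => Ez dz; have defz : defect z = z - d (hom z).
  by rewrite /defect dz /hom twb_ext0 subr0.
have [x dx] : exists x, d x = defect z.
  by apply: IH => //; rewrite defz dD dN dz dd subrr.
by exists (x + hom z); rewrite dD dx defz subrK.
Qed.

(** * The augmentation and exactness in degree zero *)

Local Notation eps := (eps q G).

(** [eps] has R as codomain, which hides its linearity; this is the same map into the regular module
    of R^c. *)
Let eps_linear := fglift (fun s : symbol G 0 => mono q (val s).2 : (R^c)^o).

Lemma epsD (x z : L 0) : eps (x + z) = eps x + eps z.
Proof. exact: (linearD eps_linear x z). Qed.

Lemma epsN (z : L 0) : eps (- z) = - eps z.
Proof. exact: (linearN eps_linear z). Qed.

Lemma eps0 : eps 0 = 0.
Proof. exact: (linear0 eps_linear). Qed.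

Lemma eps_ract (z : L 0) (r : R) : eps (ract z r) = eps z * r.
Proof. exact: (linearZZ eps_linear (r : R^c) z). Qed.

Lemma eps_kscal (z : L 0) (e : k) : eps (kscal e z) = e *: eps z.
Proof. by rewrite /kscal eps_ract -scalerAr mulr1. Qed.

Lemma admissible_nil (s : 0.-tuple 'I_n) u : admissible G (s, u) = (u \in G).
Proof. by rewrite tuple0 /admissible /= !andbT. Qed.

Lemma eps_twb (s : 0.-tuple 'I_n) u c : u \in G -> eps (twb s u c) = mono q (u + c)%MM.
Proof.
move=> uG; have adm : admissible G (s, u) by rewrite admissible_nil.
have Es : eps (ebasis q G s u) = mono q u by rewrite /ebasis insubT /Defs.eps liftU scale1r.
rewrite /twisted_basis eps_kscal eps_ract Es mono_mul scalerA tuple0 /xprod big_nil add0m.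
by rewrite mulVr ?scale1r // skewC_unit.
Qed.

Lemma gfun_quotient i u c :
  up G u -> (g i u + (c + y i u) = u + (c + U_(i)))%MM.
Proof.
move=> uU; have /mnm_lepP le_g := gfun_le GP (up_var i uU).
by apply/mnmP => l; have := le_g l; rewrite !(mnmDE, mnmBE); lia.
Qed.

(** The two terms of d E((i), u, c) both have product u * x_i * c, since g(x_i * u) * y = x_i *
    u. *)
Lemma eps_d (z : L 1) : eps (d z) = 0.
Proof.
elim/L_ind: z => [|x z dx dz|e s c].
- by rewrite d0 eps0.
- by rewrite dD epsD dx dz addr0.
have [sG sI _] := admissibleP _ _ _ (valP s : admissible G ((val s).1, (val s).2)).
rewrite d_kscal d_twb // big_ord1 -kscal_sign !eps_kscal.
rewrite epsD epsN !eps_twb ?gfun_in ?up_var ?up_gen //.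
by rewrite gfun_quotient ?up_gen // subrr !scaler0.
Qed.

(** On the ideal this is a k-linear section of [eps], given by canonical decompositions. Outside it
    [gfun] returns 1, which is then not in G, so the value is 0. *)
Definition canonical_lift : R -> L 0 :=
  additive_ext (fun (w : 'X_{1..n}) (e : k) =>
    kscal e (twb [tuple] (gfun G w) (w - gfun G w)%MM)).

Lemma canonical_liftD (f h : R) :
  canonical_lift (f + h) = canonical_lift f + canonical_lift h.
Proof. by apply: additive_extD => w a b; apply: kscalDl. Qed.

Lemma canonical_lift_mono (e : k) w :
  canonical_lift (e *: mono q w) = kscal e (twb [tuple] (gfun G w) (w - gfun G w)%MM).
Proof.
have -> : e *: mono q w = << e *g w >> :> {freeg 'X_{1..n} / k}.
  by apply/eqP/freeg_eqP => t; rewrite coeffZ !coeffU mul1r.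
by apply: (additive_extU (g := fun (w : 'X_{1..n}) (e : k) => _)) => v a b; apply: kscalDl.
Qed.

(** If c has a variable x_m before max(u), a boundary replaces u by the lexicographically larger
    g(x_m * u) without changing the product u * c. The process stops at the canonical
    decomposition. *)
Lemma twb_sub_lift b u (s : 0.-tuple 'I_n) c :
  u \in G -> (mdeg (u + c)%MM < b)%N ->
  exists x : L 1, d x = twb s u c - canonical_lift (mono q (u + c)%MM).
Proof.
elim/(@lexlt_ind n b): u s c => u IH s c uG deg_lt; have uU := up_gen uG.
rewrite [s]tuple0 {s} -[mono q _]scale1r canonical_lift_mono kscal1.
have [/max_le_minP le_uc|] := boolP (max_le_min u c).
  have -> : gfun G (u + c)%MM = u.
    apply: gfun_eq => //; rewrite /canonical_factor uG lem_addr /=.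
    by rewrite [(u + c)%MM]addmC addmK; apply/max_le_minP.
  by exists 0; rewrite d0 [(u + c)%MM]addmC addmK subrr.
move=> /forallPn[m]; rewrite negb_imply -ltnNge => /andP[cm mu].
have deg' := mdeg_quotient m uU; have degc := mdeg_sub_var cm.
have gG : g m u \in G by rewrite gfun_in ?up_var.
have le_g := gfun_le GP (up_var m uU).
have Ew : (g m u + (c - U_(m) + y m u) = u + c)%MM.
  by rewrite gfun_quotient // submK // lep1mP -lt0n.
have [||x dx] := IH (g m u) (lexlt_gfun_var GP uG mu) _ [tuple] (c - U_(m) + y m u)%MM gG.
- by move: deg_lt; rewrite mdegD; lia.
- by rewrite Ew.
rewrite Ew -[mono q _]scale1r canonical_lift_mono kscal1 in dx.
(* The differential of E((m), u, c / x_m) is minus the difference of E for u and E for g(x_m * u),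
   hence the subtraction. *)
exists (x - twb (consT m [tuple]) u (c - U_(m))%MM).
rewrite dD dN dx d_twb // big_ord1 expr1 scaleN1r opprK drop_nth_consT0.
have -> : tnth (consT m [tuple]) ord0 = m by [].
rewrite submK ?lep1mP -?lt0n // addrC addrA subrK; congr (_ - _).
Qed.

(** Modulo boundaries every z is the canonical lift of its image under [eps], which is 0 when that
    image is 0. *)
Lemma exact_L0 (z : L 0) : eps z = 0 -> exists x, d x = z.
Proof.
move=> ez; suff [x dx] : exists x, d x = z - canonical_lift (eps z).
  exists x; rewrite dx ez /canonical_lift; have := canonical_lift_mono 0 0%MM.
  by rewrite scale0r kscal0l /canonical_lift => ->; rewrite subr0.
have lift0 : canonical_lift 0 = 0.
  by have := canonical_lift_mono 0 0%MM; rewrite scale0r kscal0l.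
elim/L_ind: z {ez} => [|z1 z2 [x1 dx1] [x2 dx2]|e s c].
- by exists 0; rewrite d0 eps0 lift0 subrr.
- exists (x1 + x2); rewrite dD dx1 dx2 epsD canonical_liftD opprD; exact: addrACA.
have [sG _ _] := admissibleP _ _ _ (valP s : admissible G ((val s).1, (val s).2)).
have [x dx] := twb_sub_lift (val s).1 sG (ltnSn (mdeg ((val s).2 + c)%MM)).
exists (kscal e x); rewrite d_kscal dx kscalB eps_kscal (eps_twb _ _ sG).
by rewrite canonical_lift_mono -[mono q _]scale1r canonical_lift_mono kscal1.
Qed.

End Homotopy.

(** * Stable ideals and minimality *)

Section FunctionConcatenation.
Context (T : Type) (m1 m2 : nat) (f1 : 'I_m1 -> T) (f2 : 'I_m2 -> T).

Definition fcat (i : 'I_(m1 + m2)) : T :=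
  match fintype.split i with inl j => f1 j | inr j => f2 j end.

Lemma fcat_lshift j : fcat (lshift m2 j) = f1 j.
Proof. by rewrite /fcat (unsplitK (inl _ j)). Qed.

Lemma fcat_rshift j : fcat (rshift m1 j) = f2 j.
Proof. by rewrite /fcat (unsplitK (inr _ j)). Qed.

Lemma fcatP (P : T -> Prop) : (forall j, P (f1 j)) -> (forall j, P (f2 j)) -> forall i, P (fcat i).
Proof. by move=> P1 P2 i; rewrite /fcat; case: fintype.split. Qed.
End FunctionConcatenation.

Section GeneratedIdeals.
Context (A : nzRingType) (S : A -> Prop).

Lemma ideal_gen0 : ideal_gen S 0.
Proof.
by exists 0%N, (fun _ => 0), (fun _ => 0), (fun _ => 0); split=> [[]//|]; rewrite big_ord0.
Qed.

Lemma ideal_genD f h : ideal_gen S f -> ideal_gen S h -> ideal_gen S (f + h).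
Proof.
move=> [m1 [a1 [s1 [b1 [S1 ->]]]]] [m2 [a2 [s2 [b2 [S2 ->]]]]].
exists (m1 + m2)%N, (fcat a1 a2), (fcat s1 s2), (fcat b1 b2); split; first exact: fcatP.
by rewrite big_split_ord; congr (_ + _); apply: eq_bigr => i _;
  rewrite ?fcat_lshift ?fcat_rshift.
Qed.

Lemma ideal_gen_mul a s b : S s -> ideal_gen S (a * s * b).
Proof.
by move=> Ss; exists 1%N, (fun _ => a), (fun _ => s), (fun _ => b); rewrite big_ord1.
Qed.

Lemma mod_mul_ideal0 (M : lmodType A^c) : mod_mul_ideal S (0 : M).
Proof. by exists 0%N, (fun _ => 0), (fun _ => 0); split=> [[]//|]; rewrite big_ord0. Qed.

Lemma mod_mul_idealD (M : lmodType A^c) (y z : M) :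
  mod_mul_ideal S y -> mod_mul_ideal S z -> mod_mul_ideal S (y + z).
Proof.
move=> [m1 [y1 [r1 [S1 ->]]]] [m2 [y2 [r2 [S2 ->]]]].
exists (m1 + m2)%N, (fcat y1 y2), (fcat r1 r2); split; first exact: fcatP.
by rewrite big_split_ord; congr (_ + _); apply: eq_bigr => i _;
  rewrite ?fcat_lshift ?fcat_rshift.
Qed.

Lemma mod_mul_ideal_ract (M : lmodType A^c) (z : M) r : S r -> mod_mul_ideal S (ract z r).
Proof. by move=> Sr; exists 1%N, (fun _ => z), (fun _ => r); rewrite big_ord1. Qed.

End GeneratedIdeals.

(** * From the ideal to its exponents, and minimality *)

Section StableIdeal.
Context (k : comUnitRingType) (n : nat) (q : 'M[k]_n) (G : {pred 'X_{1..n}}).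
Context (qP : skew_param q).
Local Notation R := (skewpoly q).
Implicit Types u v w c : 'X_{1..n}.

(** Reordering variables only changes scalars, so every monomial of a x^u b is a multiple of x^u. *)
Lemma coeff_mul_mono (a b : R) u w : ~~ (u <= w)%MM -> coeff w (a * mono q u * b) = 0.
Proof.
move=> nuw; have cD (f h : R) : coeff w (f + h) = coeff w f + coeff w h by exact: coeffD.
have cZ (e : k) (f : R) : coeff w (e *: f) = e * coeff w f by exact: coeffZ.
have c0 : coeff w (0 : R) = 0 by exact: coeff0.
elim/skewpoly_ind: a => [|e a f IHa]; first by rewrite !mul0r.
rewrite !mulrDl cD {}IHa addr0 -!scalerAl cZ.
suff -> : coeff w (mono q a * mono q u * b) = 0 by rewrite mulr0.
elim/skewpoly_ind: b => [|e' b f' IHb]; first by rewrite mulr0.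
rewrite mulrDr cD {}IHb addr0 -scalerAr cZ mono_mul -scalerAl cZ mono_mul cZ.
rewrite /mono coeffU; case: eqP => [E|_]; last by rewrite !mulr0.
case/negP: nuw; rewrite -E; apply: lepm_trans (lem_addr _ _); exact: lem_addl.
Qed.

Lemma mono_ideal_up (f : R) w :
  mono_ideal (fun a => a \in G) f -> ~~ up G w -> coeff w f = 0.
Proof.
move=> [m [a [s [b [sG ->]]]]] nw; rewrite (@raddf_sum _ _ (coeff w)) big1 // => i _.
have [u uG ->] := sG i; apply: coeff_mul_mono; apply: contraNN nw => uw.
by apply/upP; exists u.
Qed.

Lemma mono_in_ideal u (e : k) : up G u ->
  mono_ideal (fun a => a \in G) (e *: mono q u : R).
Proof.
move=> /upP[v vG vu]; have -> : e *: mono q u =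
    1 * mono q v * ((e * (skewC q v (u - v)%MM)^-1) *: mono q (u - v)%MM).
  by rewrite mul1r -scalerAr mono_mul scalerA mulrVK ?skewC_unit // addmC submK.
by apply: ideal_gen_mul; exists v.
Qed.

Context (I : R -> Prop) (IS : stable I) (IG : minimal_generators I G).

(** An element of I has coefficient 0 at monomials that no generator divides, whereas x^w has
    coefficient 1 at itself. *)
Lemma mem_mono w : I (mono q w) <-> up G w.
Proof.
split=> [/IG.1/mono_ideal_up h|wU]; last first.
  by apply/IG.1; rewrite -[mono q w]scale1r; apply: mono_in_ideal.
by apply: contraT => /h; rewrite /mono coeffU eqxx mulr1 => /eqP; rewrite oner_eq0.
Qed.

Lemma stable_ideal_antichain : stable_antichain G.
Proof.
split; first exact: IG.2.
by move=> w i j /mem_mono wI mw ij; apply/mem_mono/IS.2.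
Qed.
Let GP := stable_ideal_antichain.

Lemma eps_in_ideal (z : L q G 0) : I (eps q G z).
Proof.
apply/IG.1; elim/(@L_ind k n q G qP): z => [|x z Ix Iz|e s c].
- by rewrite eps0; apply: ideal_gen0.
- by rewrite epsD; apply: ideal_genD.
have [sG _ _] := admissibleP _ _ _ (valP s : admissible G ((val s).1, (val s).2)).
rewrite eps_kscal (eps_twb qP _ _ sG); apply: mono_in_ideal.
by apply: up_le (up_gen sG); apply: lem_addr.
Qed.

Lemma eps_surj (f : R) : I f -> exists z : L q G 0, eps q G z = f.
Proof.
move/IG.1 => [m [a [s [b [sG ->]]]]]; elim/big_ind: _.
- by exists 0; apply: eps0.
- by move=> f1 f2 [z1 <-] [z2 <-]; exists (z1 + z2); apply: epsD.
(* The map is only right linear, so the right factor acts on L_0, while each monomial of the left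
   factor is absorbed by decomposing its product with u canonically. *)
move=> i _; suff [z ez] : exists z : L q G 0, eps q G z = a i * s i.
  by exists (ract z (b i)); rewrite eps_ract ez.
have [u uG ->] := sG i; elim/skewpoly_ind: (a i) => [|e w h [z ez]].
  by exists 0; rewrite eps0 mul0r.
have wU : up G (w + u)%MM by apply: up_le (up_gen uG); apply: lem_addl.
exists (kscal (e * skewC q w u)
  (twisted_basis q G [tuple] (gfun G (w + u)) (w + u - gfun G (w + u))%MM) + z).
rewrite epsD ez eps_kscal (eps_twb qP) ?gfun_in // addmC submK ?gfun_le //.
by rewrite mulrDl -scalerAl mono_mul scalerA.
Qed.

Lemma mono_in_irrelevant (e : k) c : c != 0%MM -> irrelevant_ideal (e *: mono q c : R).
Proof.
move=> /mmax_attained[i _ ci]; have le_ic : (U_(i) <= c)%MM by rewrite lep1mP -lt0n.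
have -> : e *: mono q c =
    ((e * (skewC q (c - U_(i))%MM U_(i))^-1) *: mono q (c - U_(i))%MM) * var q i * 1.
  by rewrite mulr1 -scalerAl mono_mul submK // scalerA mulrVK // skewC_unit.
by apply: ideal_gen_mul; exists i.
Qed.

Lemma twb_minimal p (s : p.-tuple 'I_n) u c (e : k) : c != 0%MM ->
  mod_mul_ideal (@irrelevant_ideal k n q) (kscal e (twisted_basis q G s u c)).
Proof.
move=> c0; rewrite /twisted_basis kscalA -ractZ; apply: mod_mul_ideal_ract.
exact: mono_in_irrelevant.
Qed.

(** Every term of the differential of E(sigma, u, c) ends in c * x_i or c * y_r, and neither of
    these is 1. *)
Lemma d_minimal : minimal_differential q G.
Proof.
move=> p; elim/(@L_ind k n q G qP) => [|x z dx dz|e s c].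
- by rewrite d0; apply: mod_mul_ideal0.
- by rewrite dD; apply: mod_mul_idealD.
have [sG sI _] := admissibleP _ _ _ (valP s : admissible G ((val s).1, (val s).2)).
rewrite d_kscal (d_twb qP GP) // kscal_sum; elim/big_ind: _.
- exact: mod_mul_ideal0.
- by move=> x z; apply: mod_mul_idealD.
move=> r _; rewrite -kscal_sign kscalA kscalB -kscalNl; apply: mod_mul_idealD.
  by apply: twb_minimal; rewrite mnmD_eq0 mnm1_eq0 andbF.
apply: twb_minimal; rewrite mnmD_eq0 negb_and; apply/orP; right.
(* If y_r were 1, then g(x_i * u) would be x_i * u itself. *)
set i := tnth _ r; apply: contraNneq (gfun_var_neq GP i sG) => y0.
have := submK (gfun_le GP (up_var i (up_gen sG))); rewrite y0 add0m => {1}->.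
exact: eqxx.
Qed.

End StableIdeal.

Theorem theorem3p4 (k : comUnitRingType) (n : nat) (q : 'M[k]_n)
    (I : skewpoly q -> Prop) (G : {pred 'X_{1..n}}) :
  noetherian k -> skew_param q -> stable I -> minimal_generators I G ->
  free_resolution G I /\
  (GRing.field_axiom k -> minimal_differential q G).
Proof.
move=> _ qP IS IG; have GP := stable_ideal_antichain qP IS IG.
split=> [|_]; last exact: d_minimal IS IG.
split=> [f|z|p z].
- by split=> [|[z <-]]; [apply: eps_surj | apply: eps_in_ideal].
- by split=> [|[x <-]]; [apply: exact_L0 | apply: eps_d].
- by split=> [|[x <-]]; [apply: exact_L | apply: dd].
Qed.
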